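(* For any $R>\sqrt2$ and any $k\in\{0,1,\ldots,d\}$ there exists a constant $c_k(R)$ such that for every nonempty compact set $K\subset\mathbb{R}^d$ the following holds. For every $r>0$ with $r\ge R|K|$, $$\operatorname{reach}\big(\widetilde{K(r)}\big)\ge|K|\sqrt{R^2-1},$$ $\partial K(r)$ is a $(d-1)$-dimensional Lipschitz submanifold, and $$\sup_{r\ge R|K|,\ r>0}\frac{C_k^{var}(K(r),\mathbb{R}^d)}{r^k}\le c_k(R).$$
   Context: $|K|$ is the diameter of $K$; $K(r):=\{x\in\mathbb{R}^d: d(x,K)\le r\}$ is the closed $r$-parallel set; $\widetilde{K(r)}:=\overline{K(r)^c}$ is the closure of its complement. The reach of a closed set $X$ is the supremum of all $s>0$ such that every point $x$ in the $s$-parallel set of $X$ has a unique nearest point $\Pi_X(x)$ in $X$. For a set $X$ of positive reach, Federer's curvature measures $C_k(X,\cdot)$, $k=0,\ldots,d$, are the signed measures determined by $\mathrm{vol}\{x: d(x,X)\le\varepsilon,\ \Pi_X(x)\in B\}=\sum_{k=0}^d\omega_{d-k}\,\varepsilon^{d-k}C_k(X,B)$ for $0<\varepsilon<\operatorname{reach}X$ and bounded Borel $B$ ($\omega_j$ = volume of the unit ball of $\mathbb{R}^j$). When $\widetilde{K(r)}$ has positive reach and Lipschitz boundary one puts, for $k\le d-2$, $C_k(K(r),\cdot):=(-1)^{d-1-k}C_k(\widetilde{K(r)},\cdot)$; $C_{d-1}(K(r),\cdot)$ is the $(d-1)$-dimensional Hausdorff measure on $\partial K(r)$; $C_d(K(r),\cdot)$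 is Lebesgue measure restricted to $K(r)$. $C_k^{var}(K(r),\cdot)$ denotes the variation measure of $C_k(K(r),\cdot)$. The constant $c_k(R)$ may depend on the dimension $d$. *)

(* Defs.v *)
From HB Require Import structures.
From mathcomp Require Import all_boot all_order all_algebra.
From mathcomp Require Import all_classical all_reals all_analysis.
Set Implicit Arguments.
Unset Strict Implicit.
Unset Printing Implicit Defensive.
Import Order.TTheory GRing.Theory Num.Theory.
Import numFieldNormedType.Exports.
Local Open Scope classical_set_scope.
Local Open Scope ring_scope.

(* R^d is 'rV[R]_d. The library norm on 'rV[R]_d is the sup
   norm; it is used here only for the topology (open, closure, interior,
   compact, the Borel sets) and for boundedness of sets, which are the same as
   for the Euclidean norm. All metric notions below use [enorm]. *)

Section EuclideanGeometry.
Variables (R : realType) (d : nat).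
Local Notation E := 'rV[R]_d.
Implicit Types (x y : E) (K X A : set E) (r s : R).

Definition enorm x : R := Num.sqrt (\sum_(i < d) x ord0 i ^+ 2).

(* Real suprema and infima: [inf] and [sup] return 0 on the empty set, and
   [diam] is meaningful on bounded sets only. *)
Definition dist_to X x : R := inf [set enorm (x - y) | y in X].

Definition diam A : R := sup [set t | exists x y, [/\ A x, A y & t = enorm (x - y)]].

Definition parallel_set K r : set E := [set x | dist_to K x <= r].

Definition copar_set K r : set E := closure (~` parallel_set K r).

Definition frontier A : set E := closure A `\` interior A.

Definition nearest X x : set E := [set y | X y /\ enorm (x - y) = dist_to X x].

Definition metric_proj X x : E := xget 0 (nearest X x).

(* The maximum with 0 only serves the case where no s > 0 qualifies, since
   [ereal_sup set0] is -oo. *)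
Definition reach X : \bar R :=
  maxe 0%E (ereal_sup [set s%:E | s in [set s : R | 0 < s /\
    forall x, parallel_set X s x -> exists! y, nearest X x y]]).

(* M is locally the graph of a Lipschitz map from an m-dimensional linear
   subspace to its orthogonal complement; P is the orthogonal projection onto
   the subspace. *)
Definition lipschitz_submanifold (m : nat) (M : set E) : Prop :=
  forall x, M x ->
  exists (U : set E) (P : 'M[R]_d) (g : E -> E) (L : R),
    [/\ open U /\ U x,
        [/\ P^T = P, P *m P = P & \rank P = m],
        forall y, g y *m P = 0,
        forall y z, enorm (g y - g z) <= L * enorm (y - z)
      & M `&` U = U `&` [set y | y - y *m P = g (y *m P)]].

Definition borel : set (set E) := <<s [set A : set E | open A] >>.

End EuclideanGeometry.

(* d-dimensional Lebesgue measure of Borel sets, as the d-fold iterated product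
   of the one-dimensional Lebesgue measure; the first coordinate is integrated
   last. *)
Fixpoint vol (R : realType) (d : nat) : set 'rV[R]_d -> \bar R :=
  match d return set 'rV[R]_d -> \bar R with
  | 0%N => fun A => (\1_A (0 : 'rV[R]_0))%:E
  | d'.+1 => fun A => (\int[@lebesgue_measure R]_t
      vol [set v : 'rV[R]_d' | A (row_mx (t%:M : 'rV[R]_1) v : 'rV[R]_(1 + d'))])%E
  end.

Definition omega (R : realType) (j : nat) : R :=
  fine (vol [set x : 'rV[R]_j | enorm x <= 1]).

Section Measures.
Variables (R : realType) (d : nat).
Local Notation E := 'rV[R]_d.
Implicit Types (K X A B : set E) (r : R).

(* The empty set has gauge 0 also for m = 0, where 0 ^+ 0 = 1. *)
Definition hausdorff_gauge (m : nat) (A : set E) : R :=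
  if `[< A !=set0 >] then omega R m * (diam A / 2) ^+ m else 0.

Definition hausdorff_pre (m : nat) (delta : R) (A : set E) : \bar R :=
  ereal_inf [set (\sum_(0 <= i <oo) (hausdorff_gauge m (U i))%:E)%E |
    U in [set U : nat -> set E | A `<=` \bigcup_i U i /\
      forall i x y, U i x -> U i y -> enorm (x - y) <= delta]].

Definition hausdorff_measure (m : nat) (A : set E) : \bar R :=
  ereal_sup [set hausdorff_pre m delta A | delta in [set delta : R | 0 < delta]].

(* Signed Radon measures: a curvature measure of an unbounded set need not be
   finite, so values are prescribed on bounded Borel sets only. *)
Definition signed_measure (mu : set E -> R) : Prop :=
  mu set0 = 0 /\
  forall F : nat -> set E, (forall i, borel (F i)) -> trivIset setT F ->
    bounded_set (\bigcup_i F i) ->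
    (\sum_(0 <= i < n) mu (F i)) @[n --> \oo] --> mu (\bigcup_i F i).

(* Variation on A of a set function that is additive on bounded Borel sets. *)
Definition variation_measure (mu : set E -> \bar R) (A : set E) : \bar R :=
  ereal_sup [set v | exists (n : nat) (F : 'I_n -> set E),
    [/\ forall i, [/\ borel (F i), bounded_set (F i) & F i `<=` A],
        trivIset setT F
      & v = (\sum_(i < n) `|mu (F i)|)%E]].

(* C k B stands for C_k(X, B). *)
Definition is_curvature_measures X (C : nat -> set E -> R) : Prop :=
  (forall k, (k <= d)%N -> signed_measure (C k)) /\
  forall (e : R) (B : set E), 0 < e -> (e%:E < reach X)%E ->
    borel B -> bounded_set B ->
    vol [set x | parallel_set X e x /\ B (metric_proj X x)] =
    (\sum_(k < d.+1) omega R (d - k) * e ^+ (d - k) * C k B)%:E.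

(* For closed X of positive reach such a family exists (Federer) and its
   members of index at most d are unique on bounded Borel sets: the right-hand
   side is a polynomial in e on a nondegenerate interval. *)
Definition curvature_measures X : nat -> set E -> R :=
  xget (fun _ _ => 0) [set C | is_curvature_measures X C].

(* C_k(K(r), -), for k <= d. *)
Definition parallel_curvature K r (k : nat) (B : set E) : \bar R :=
  if k == d then vol (parallel_set K r `&` B)
  else if k.+1 == d then hausdorff_measure d.-1 (frontier (parallel_set K r) `&` B)
  else ((-1) ^+ (d.-1 - k) * curvature_measures (copar_set K r) k B)%:E.

End Measures.

(* Main.v *)
(* Write D = |K|, X for the closure of the complement of K(r), and S for the
   boundary of K(r), which is the level set {d(., K) = r}.

   Reach. The squared distance to K minus |x|^2 is concave, so the midpoint m
   of two nearest points y1, y2 of x in X satisfies d(m, K)^2 >= r^2 - h^2 with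
   h = |y1 - y2| / 2. For x0 in K and u = (m - x0) / |m - x0| one has
   <m - p, u> >= sqrt (r^2 - D^2 - h^2) for all p in K (AM-GM), so moving m along
   u by sqrt (r^2 - D^2) - sqrt (r^2 - D^2 - h^2) leads into X, at a point closer
   to x than y1 as soon as d(x, X) < sqrt (r^2 - D^2).

   Boundary. K(r) contains a truncated cone of fixed aperture, with axis
   directed towards a point of K, below each of its points near S; hence S is
   locally the graph of a supremum of 8-Lipschitz functions.

   Curvature. For k = d the claim is a volume bound. For k = d - 1, the radial
   projection from a point of K identifies S with the surface of a cube in a
   Lipschitz way, and additivity of the Hausdorff measure on Borel sets is
   Caratheodory's criterion. For k <= d - 2 the part of B off S contributes a
   term independent of eps to the Steiner formula, so inverting a Vandermonde
   system at d + 1 values of eps below r / 2 < reach X bounds C_k(B) by the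
   volumes of disjoint subsets of K(r). *)

From HB Require Import structures.
Require Import Defs.
From mathcomp Require Import all_boot all_order all_algebra.
From mathcomp Require Import all_classical all_reals all_analysis.
From mathcomp Require Import measurable_realfun.
From mathcomp Require Import ring lra zify.
Set Implicit Arguments.
Unset Strict Implicit.
Unset Printing Implicit Defensive.
Import Order.TTheory GRing.Theory Num.Theory.
Import numFieldNormedType.Exports.
Local Open Scope classical_set_scope.
Local Open Scope ring_scope.

(** * Euclidean geometry *)

Section Euclid.
Variables (R : realType) (d : nat).
Local Notation E := 'rV[R]_d.
Implicit Types x y z u v : E.

Definition dot u v : R := \sum_(i < d) u ord0 i * v ord0 i.

Lemma dotC u v : dot u v = dot v u.
Proof. by apply: eq_bigr => i _; rewrite mulrC. Qed.

Lemma dotDl u v w : dot (u + v) w = dot u w + dot v w.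
Proof. by rewrite -big_split; apply: eq_bigr => i _; rewrite mxE mulrDl. Qed.

Lemma dotZl a u w : dot (a *: u) w = a * dot u w.
Proof. by rewrite mulr_sumr; apply: eq_bigr => i _; rewrite mxE mulrA. Qed.

Lemma dotNl u w : dot (- u) w = - dot u w.
Proof. by rewrite -scaleN1r dotZl mulN1r. Qed.

Lemma dotDr u v w : dot w (u + v) = dot w u + dot w v.
Proof. by rewrite !(dotC w) dotDl. Qed.

Lemma dotZr a u w : dot w (a *: u) = a * dot w u.
Proof. by rewrite !(dotC w) dotZl. Qed.

Lemma dotNr u w : dot w (- u) = - dot w u.
Proof. by rewrite !(dotC w) dotNl. Qed.

Definition dotE := (dotDl, dotDr, dotNl, dotNr, dotZl, dotZr).

Lemma dot_ge0 u : 0 <= dot u u.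
Proof. by apply: sumr_ge0 => i _; rewrite -expr2 sqr_ge0. Qed.

Lemma enorm_sqr u : enorm u ^+ 2 = dot u u.
Proof.
rewrite /enorm; under eq_bigr do rewrite expr2.
by rewrite sqr_sqrtr // dot_ge0.
Qed.

Lemma enorm_ge0 u : 0 <= enorm u.
Proof. exact: sqrtr_ge0. Qed.

Lemma coord_le_enorm u i : `|u ord0 i| <= enorm u.
Proof.
rewrite -(@ler_sqr _ `|_|) ?nnegrE ?enorm_ge0 // real_normK ?num_real //.
rewrite enorm_sqr /dot (bigD1 i) //= -expr2 lerDl.
by apply: sumr_ge0 => j _; rewrite -expr2 sqr_ge0.
Qed.

Lemma enorm0 : enorm (0 : E) = 0.
Proof. by apply/eqP; rewrite -sqrf_eq0 enorm_sqr -(scale0r 0) dotZl mul0r. Qed.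

Lemma enorm_eq0 u : (enorm u == 0) = (u == 0).
Proof.
apply/idP/eqP => [/eqP u0|->]; last by rewrite enorm0.
apply/rowP => i; rewrite mxE; apply/eqP; rewrite -normr_le0 -u0.
exact: coord_le_enorm.
Qed.

Lemma enorm_gt0 u : (0 < enorm u) = (u != 0).
Proof. by rewrite lt_def enorm_ge0 andbT enorm_eq0. Qed.

Lemma enormZ a u : enorm (a *: u) = `|a| * enorm u.
Proof.
apply/eqP; rewrite -(eqrXn2 (n := 2)) ?mulr_ge0 ?enorm_ge0 //.
by rewrite exprMn !enorm_sqr !dotE real_normK ?num_real // expr2 mulrA.
Qed.

Lemma enormN u : enorm (- u) = enorm u.
Proof. by rewrite -scaleN1r enormZ normrN1 mul1r. Qed.

Lemma enormC u v : enorm (u - v) = enorm (v - u).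
Proof. by rewrite -enormN opprB. Qed.

Lemma dot_le_enorm u v : dot u v <= enorm u * enorm v.
Proof.
have [->|v0] := eqVneq v 0.
  by rewrite -(scale0r 0) dotZr mul0r mulr_ge0 ?enorm_ge0.
have [n0|/ltW n0] := leP (dot u v) 0.
  by rewrite (le_trans n0) // mulr_ge0 ?enorm_ge0.
rewrite -(@ler_sqr _ (dot u v)) ?nnegrE ?mulr_ge0 ?enorm_ge0 //.
rewrite exprMn.
(* This vector is [enorm v ^+ 2] times the component of [u] orthogonal to [v]; its squared norm is
   [a * (a * b - c ^+ 2)] in the notation below. *)
have := dot_ge0 (enorm v ^+ 2 *: u - dot u v *: v).
rewrite !dotE -!enorm_sqr (dotC v u).
have : 0 < enorm v ^+ 2 by rewrite exprn_gt0 // enorm_gt0.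
move: (enorm v ^+ 2) (enorm u ^+ 2) (dot u v) => a b c a0 H.
rewrite -(ler_pM2l a0); nra.
Qed.

Lemma normr_dot_le u v : `|dot u v| <= enorm u * enorm v.
Proof.
rewrite ler_norml dot_le_enorm andbT lerNl -dotNl -(enormN u).
exact: dot_le_enorm.
Qed.

Lemma enormD_sqr u v :
  enorm (u + v) ^+ 2 = enorm u ^+ 2 + 2 * dot u v + enorm v ^+ 2.
Proof. by rewrite !enorm_sqr !dotE (dotC v u); ring. Qed.

Lemma ler_enormD u v : enorm (u + v) <= enorm u + enorm v.
Proof.
rewrite -ler_sqr ?nnegrE ?addr_ge0 ?enorm_ge0 // enormD_sqr.
by have := dot_le_enorm u v; nra.
Qed.

Lemma ler_enormB u v : enorm u - enorm v <= enorm (u - v).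
Proof. by rewrite lerBlDr (le_trans _ (ler_enormD _ _)) // subrK. Qed.

Lemma enorm_le_sum u : enorm u <= \sum_(i < d) `|u ord0 i|.
Proof.
have h : 0 <= \sum_(i < d) `|u ord0 i| by exact: sumr_ge0.
rewrite -ler_sqr ?nnegrE ?enorm_ge0 // enorm_sqr [leRHS]expr2 mulr_suml.
apply: ler_sum => i _; apply: le_trans (ler_norm _) _; rewrite normrM.
by apply: ler_wpM2l => //; rewrite (bigD1 i) //= lerDl sumr_ge0.
Qed.

Lemma enorm_le_coord u M : (forall i, `|u ord0 i| <= M) -> enorm u <= M *+ d.
Proof.
move=> h; apply: le_trans (enorm_le_sum _) _.
by apply: le_trans (ler_sum _ (fun i _ => h i)) _; rewrite sumr_const card_ord.
Qed.

Lemma coord_le_norm u i : `|u ord0 i| <= `|u|.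
Proof.
rewrite [leRHS]/Num.norm /= mx_normrE.
by apply/bigmax_geP; right => /=; exists (ord0, i).
Qed.

Lemma norm_le_coord u M : 0 <= M -> (forall i, `|u ord0 i| <= M) -> `|u| <= M.
Proof.
move=> M0 h; rewrite [leLHS]/Num.norm /= mx_normrE.
by apply/bigmax_leP; split => // -[i j] _ /=; rewrite (ord1 i).
Qed.

Lemma norm_le_enorm u : `|u| <= enorm u.
Proof. by apply: norm_le_coord => [|i]; rewrite ?enorm_ge0 ?coord_le_enorm. Qed.

Lemma enorm_le_norm u : enorm u <= `|u| *+ d.
Proof. by apply: enorm_le_coord => i; exact: coord_le_norm. Qed.

Lemma nbhs_enorm_ball x e : 0 < e -> nbhs x [set y | enorm (x - y) < e].
Proof.
(* The comparison of the norms costs a factor [d]; [d.+1] also covers dimension 0. *)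
move=> e0; apply/nbhs_ballP; exists (e / d.+1%:R); first by rewrite /= divr_gt0.
move=> y; rewrite mx_norm_ball /ball_ /= ltr_pdivlMr // => h.
apply: le_lt_trans (enorm_le_norm _) (le_lt_trans _ h).
by rewrite -[leLHS]mulr_natr ler_wpM2l // ler_nat.
Qed.

Lemma nbhs_enormP x (A : set E) :
  nbhs x A <-> exists2 e, 0 < e & forall y, enorm (x - y) < e -> A y.
Proof.
split=> [/nbhs_ballP[e /= e0 h]|[e e0 h]].
  exists e => // y xy; apply: h; rewrite mx_norm_ball /ball_ /=.
  exact: le_lt_trans (norm_le_enorm _) xy.
exact: filterS (nbhs_enorm_ball x e0).
Qed.

Lemma bounded_enorm (A : set E) (M : R) :
  (forall x, A x -> enorm x <= M) -> bounded_set A.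
Proof.
move=> h; exists M; split; first exact: num_real.
move=> N MN x /h xM; apply: le_trans (norm_le_enorm _) (le_trans xM _).
exact: ltW.
Qed.

Lemma lipschitz_enorm_continuous (f : E -> R) (L : R) :
  (forall x y, `|f x - f y| <= L * enorm (x - y)) -> continuous f.
Proof.
move=> h x; apply/(@cvgrPdist_lt _ _ _ (nbhs x) (nbhs_filter x)) => e e0.
apply/nbhs_enormP.
have L0 : 0 < `|L| + 1 by rewrite ltr_wpDl.
exists (e / (`|L| + 1)); first by rewrite divr_gt0.
move=> y; rewrite ltr_pdivlMr // => xy; apply: le_lt_trans (h _ _) _.
apply: le_lt_trans _ xy; rewrite mulrC ler_wpM2l ?enorm_ge0 //.
by rewrite ler_wpDr // ler_norm.
Qed.

Lemma bounded_enorm_ex (A : set E) : bounded_set A ->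
  exists M : R, forall x, A x -> enorm x <= M.
Proof.
move=> [M [_ h]]; exists ((M + 1) *+ d) => x /(h (M + 1)) xM.
apply: le_trans (enorm_le_norm _) _; rewrite lerMn2r xM ?orbT // ltrDl //.
Qed.

End Euclid.

(** * Distance to a set, nearest points and diameter *)

Section Distance.
Variables (R : realType) (d : nat).
Local Notation E := 'rV[R]_d.
Implicit Types (x y : E) (X A K : set E).

Lemma dist_to_le X x y : X y -> dist_to X x <= enorm (x - y).
Proof.
move=> Xy; apply: ge_inf; last by exists y.
by exists 0 => _ [z _ <-]; exact: enorm_ge0.
Qed.

Lemma le_dist_to X x c : X !=set0 -> (forall y, X y -> c <= enorm (x - y)) ->
  c <= dist_to X x.
Proof.
move=> [y Xy] h; apply: lb_le_inf; first by exists (enorm (x - y)), y.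
by move=> _ [z Xz <-]; exact: h.
Qed.

Lemma dist_to_ge0 X x : X !=set0 -> 0 <= dist_to X x.
Proof. by move=> /le_dist_to; apply => y _; exact: enorm_ge0. Qed.

Lemma dist_to_lipschitz X x y : X !=set0 ->
  dist_to X x - dist_to X y <= enorm (x - y).
Proof.
move=> X0; rewrite lerBlDl -lerBlDr; apply: le_dist_to => // z Xz.
rewrite lerBlDr; apply: le_trans (dist_to_le x Xz) _.
by rewrite [leRHS]addrC (le_trans _ (ler_enormD _ _)) // addrA subrK.
Qed.

Lemma dist_to_continuous X : X !=set0 -> continuous (dist_to X).
Proof.
move=> X0; apply: (@lipschitz_enorm_continuous _ _ _ 1) => x y; rewrite mul1r.
by rewrite ler_norml dist_to_lipschitz // andbT lerNl opprB enormC
  dist_to_lipschitz.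
Qed.

Lemma enormB_continuous x : continuous (fun y : E => enorm (x - y)).
Proof.
apply: (@lipschitz_enorm_continuous _ _ _ 1) => y z /=; rewrite mul1r.
have h a b : enorm (x - a) - enorm (x - b) <= enorm (a - b).
  apply: le_trans (ler_enormB _ _) _.
  by rewrite opprB addrC addrA subrK enormC.
by rewrite ler_norml h andbT lerNl opprB (enormC y) h.
Qed.

(** The part of [X] that is no farther from [x] than a given point [y0] of [X] is closed and
    bounded, so the distance attains its minimum there. *)
Lemma nearest_ex X x : X !=set0 -> closed X -> exists y, nearest X x y.
Proof.
move=> [y0 Xy0] cX; set f := fun y : E => enorm (x - y).
pose A := X `&` f @^-1` [set t | t <= f y0].
have cA : compact A.
  apply: bounded_closed_compact.
    apply: (@bounded_enorm _ _ _ (enorm x + f y0)) => y [_ /= fy].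
    have -> : y = x + - (x - y) by rewrite opprB addrC subrK.
    by apply: le_trans (ler_enormD _ _) _; rewrite enormN lerD2l.
  apply: closedI => //; apply: closed_comp; last exact: closed_le.
  by move=> y _; exact: enormB_continuous.
have [||z zA zmin] := @EVT_min_rV _ _ f A _ cA.
- by exists y0; split => //=.
- by apply: continuous_subspaceT; exact: enormB_continuous.
move: zA; rewrite inE => -[Xz fz]; exists z; split => //.
apply/eqP; rewrite eq_le dist_to_le // andbT.
apply: le_dist_to; first by exists y0.
move=> y Xy; have [fy|fy] := leP (f y) (f y0).
  by apply: zmin; rewrite inE.
exact: le_trans fz (ltW fy).
Qed.

Lemma metric_projP X x : X !=set0 -> closed X -> nearest X x (metric_proj X x).
Proof.
move=> X0 cX; rewrite /metric_proj.
by case: xgetP => [y -> //|/= n]; have [y /n] := nearest_ex x X0 cX.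
Qed.

Lemma diam_bounded K x y : bounded_set K -> K x -> K y -> enorm (x - y) <= diam K.
Proof.
move=> /bounded_enorm_ex[M bM] Kx Ky; apply: ub_le_sup; last by exists x, y.
exists (M + M) => _ [z [w [Kz Kw ->]]].
by apply: le_trans (ler_enormD _ _) _; rewrite enormN lerD ?bM.
Qed.

Lemma diam_le K M : 0 <= M -> (forall x y, K x -> K y -> enorm (x - y) <= M) ->
  diam K <= M.
Proof.
move=> M0 h; rewrite /diam; have [->|/set0P K0] := eqVneq K set0.
  by rewrite (_ : mkset _ = set0) ?sup0 // -subset0 => t [x [y []]].
apply: ge_sup; last by move=> t [x [y [Kx Ky tE]]]; rewrite tE; exact: h.
by have [x Kx] := K0; exists (enorm (x - x)), x, x.
Qed.

Lemma diam_ge0 K : 0 <= diam K.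
Proof.
rewrite /diam; set T := mkset _.
(* On an empty or unbounded set of distances [sup] takes its default value 0. *)
have [[[t Tt] bT]|/sup_out -> //] := pselect (has_sup T).
apply: le_trans (ub_le_sup bT Tt).
by have [x [y [_ _ ->]]] := Tt; exact: enorm_ge0.
Qed.

End Distance.

(** * Parallel sets, their complements and their boundaries *)

Section Parallel.
Variables (R : realType) (d : nat) (K : set 'rV[R]_d) (r : R).
Local Notation E := 'rV[R]_d.
Hypotheses (K0 : K !=set0) (cK : compact K) (r0 : 0 < r) (Dr : diam K < r).
Implicit Types (x y p : E).
Local Notation D := (diam K).
Local Notation dist := (dist_to K).

Lemma compact_enorm_bounded : bounded_set K.
Proof. exact: compact_bounded. Qed.

Lemma rV_compact_closed : closed K.
Proof. exact: (compact_closed (@norm_hausdorff _ _) cK). Qed.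

Lemma sqr_diam_le x y : K x -> K y -> enorm (x - y) ^+ 2 <= D ^+ 2.
Proof.
move=> Kx Ky; rewrite ler_sqr ?nnegrE ?enorm_ge0 ?diam_ge0 //.
exact: diam_bounded compact_enorm_bounded Kx Ky.
Qed.

Lemma le_distP c x : c <= dist x <-> forall p, K p -> c <= enorm (x - p).
Proof.
split=> [cx p Kp|]; first exact: le_trans cx (dist_to_le _ Kp).
exact: le_dist_to.
Qed.

(** Strictness survives the infimum because [K] is closed and the infimum is attained. *)
Lemma lt_distP c x : c < dist x <-> forall p, K p -> c < enorm (x - p).
Proof.
split=> [cx p Kp|]; first exact: lt_le_trans cx (dist_to_le _ Kp).
have [p [Kp <-]] := nearest_ex x K0 rV_compact_closed; exact.
Qed.

(** The law of cosines. It turns lower bounds on distances from [x] and an upper bound on the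
    distance of [y] and [z] into a lower bound on an inner product. *)
Lemma dot_polar x y z :
  dot (x - z) (x - y) =
  (enorm (x - z) ^+ 2 + enorm (x - y) ^+ 2 - enorm (y - z) ^+ 2) / 2.
Proof.
rewrite !enorm_sqr !dotE (dotC x y) (dotC x z) (dotC y z).
by field.
Qed.

(** Both [x0] and [p] are at distance at least [r] from [x], while they are less than [r] apart. So
    they are seen from [x] under an acute angle, and moving away from [x0] increases the distance to
    every [p] in [K]. *)
Lemma dist_radial_gt x x0 t : K x0 -> r <= dist x -> 0 < t ->
  r < dist (x + t *: (x - x0)).
Proof.
move=> Kx0 xr t0; apply/lt_distP => p Kp.
have h1 : r ^+ 2 <= enorm (x - p) ^+ 2.
  by rewrite ler_sqr ?nnegrE ?enorm_ge0 ?(ltW r0) // (le_distP _ _).1.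
have h2 : r ^+ 2 <= enorm (x - x0) ^+ 2.
  by rewrite ler_sqr ?nnegrE ?enorm_ge0 ?(ltW r0) // (le_distP _ _).1.
have h3 := sqr_diam_le Kx0 Kp.
have h4 : D ^+ 2 < r ^+ 2 by rewrite ltr_sqr ?nnegrE ?diam_ge0 ?(ltW r0).
rewrite -ltr_sqr ?nnegrE ?enorm_ge0 ?(ltW r0) // addrAC enormD_sqr.
rewrite dotZr dot_polar.
have := sqr_ge0 (enorm (t *: (x - x0))).
have r2 : 0 < r ^+ 2 by rewrite exprn_gt0.
move: (r ^+ 2) (enorm (x - p) ^+ 2) (enorm (x - x0) ^+ 2) (enorm (x0 - p) ^+ 2) (D ^+ 2)
  r2 h1 h2 h3 h4 => a b c e f *; nra.
Qed.

Lemma parallel_setC : ~` parallel_set K r = [set x | r < dist x].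
Proof. by apply/seteqP; split => x /=; rewrite ltNge => /negP. Qed.

Lemma parallel_set_closed : closed (parallel_set K r).
Proof.
apply: (@closed_comp _ _ dist [set t | t <= r]); last exact: closed_le.
by move=> y _; exact: dist_to_continuous.
Qed.

Lemma radial_near x x0 e : 0 < e -> exists2 t, 0 < t &
  enorm (x - (x + t *: (x - x0))) < e.
Proof.
move=> e0; have n0 : 0 < enorm (x - x0) + 1 by rewrite ltr_wpDl ?enorm_ge0.
exists (e / (enorm (x - x0) + 1)); first by rewrite divr_gt0.
rewrite opprD addrA subrr add0r enormN enormZ gtr0_norm ?divr_gt0 //.
by rewrite mulrAC ltr_pdivrMr // ltr_pM2l // ltrDl.
Qed.

(** Points of the level set [dist x = r] belong to the closure because an arbitrarily short radial
    move takes them outside K(r). *)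
Lemma copar_setE : copar_set K r = [set x | r <= dist x].
Proof.
rewrite /copar_set parallel_setC; apply/seteqP; split.
  have cl : closed [set x | r <= dist x].
    apply: (@closed_comp _ _ dist [set t | r <= t]); last exact: closed_ge.
    by move=> y _; exact: dist_to_continuous.
  rewrite [X in _ `<=` X](closure_id _).1 //.
  by apply: closure_subset => x /=; exact: ltW.
move=> x /= xr B /nbhs_enormP[e e0 h].
have [x0 Kx0] := K0; have [t t0 te] := radial_near x x0 e0.
exists (x + t *: (x - x0)); split; last exact: h.
exact: dist_radial_gt.
Qed.

Lemma copar_set_closed : closed (copar_set K r).
Proof. exact: closed_closure. Qed.

Lemma frontierE : frontier (parallel_set K r) = [set x | dist x = r].
Proof.
rewrite /frontier -(closure_id _).1; last exact: parallel_set_closed.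
apply/seteqP; split => x /=.
  move=> [xr ni]; apply/eqP; rewrite eq_le; apply/andP; split=> //.
  rewrite leNgt; apply/negP => lt; apply: ni.
  apply/nbhs_enormP; exists (r - dist x); first by rewrite subr_gt0.
  move=> y xy; rewrite /parallel_set /=.
  have := dist_to_lipschitz y x K0; rewrite enormC => h.
  by have := le_lt_trans h xy; rewrite ltrD2r => /ltW.
move=> xr; split; first by rewrite /parallel_set /= xr.
move=> /nbhs_enormP[e e0 h].
have [x0 Kx0] := K0; have [t t0 te] := radial_near x x0 e0.
have := h _ te; rewrite /parallel_set /= leNgt => /negP; apply.
by apply: dist_radial_gt => //; rewrite xr.
Qed.

Lemma far_point_ex : (0 < d)%N -> exists x, r <= dist x.
Proof.
(* A positive dimension provides a coordinate, so [enorm e] is at least [2 * r]; passing from [x0]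
   to another point of [K] loses at most the diameter, which is below [r]. *)
move=> d0; have [x0 Kx0] := K0; pose e : E := const_mx (2 * r).
exists (x0 + e); apply/le_distP => p Kp.
have h : 2 * r <= enorm e.
  apply: le_trans (coord_le_enorm _ (Ordinal d0)).
  by rewrite mxE ler_norm.
have h1 := diam_bounded compact_enorm_bounded Kp Kx0.
have := ler_enormB e (p - x0); have -> : e - (p - x0) = x0 + e - p.
  by rewrite opprB addrA (addrC e).
by move: h h1 Dr; move: (enorm e) (enorm (p - x0)) => *; lra.
Qed.

End Parallel.

(** * Reach *)

Section Reach.
Variables (R : realType) (d : nat) (K : set 'rV[R]_d) (r : R).
Local Notation E := 'rV[R]_d.
Hypotheses (K0 : K !=set0) (cK : compact K) (r0 : 0 < r) (Dr : diam K < r).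
Implicit Types (x y p : E).
Local Notation D := (diam K).
Local Notation X := (copar_set K r).

(** Apollonius's identity for the median from [z]. The subtracted term does not involve [z], so one
    loss serves all points of [K] at once. *)
Lemma enorm_midpoint_sqr x y z :
  enorm (2^-1 *: (x + y) - z) ^+ 2 =
  (enorm (x - z) ^+ 2 + enorm (y - z) ^+ 2) / 2 - enorm (2^-1 *: (x - y)) ^+ 2.
Proof.
rewrite !enorm_sqr !dotE (dotC y x) (dotC z x) (dotC z y).
by field.
Qed.

Lemma sqr_gap_gt0 : 0 < r ^+ 2 - D ^+ 2.
Proof. by rewrite subr_gt0 ltr_sqr ?nnegrE ?diam_ge0 ?(ltW r0). Qed.

(* The midpoint m of two nearest points of x nearly lies in X; pushing it away
   from a point x0 of K brings it back to X while it stays closer to x. *)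
Lemma nearest_copar_unique x y1 y2 : dist_to X x < Num.sqrt (r ^+ 2 - D ^+ 2) ->
  nearest X x y1 -> nearest X x y2 -> y1 = y2.
Proof.
set w := Num.sqrt _ => tw [X1 n1] [X2 n2].
apply: contrapT => y12.
set t := dist_to X x in tw n1 n2.
pose m := 2^-1 *: (y1 + y2); pose h2 := enorm (2^-1 *: (y1 - y2)) ^+ 2.
have h0 : 0 < h2.
  rewrite exprn_gt0 // enorm_gt0 scaler_eq0 negb_or invr_eq0 pnatr_eq0 /=.
  by rewrite subr_eq0; apply/eqP.
have X0 : X !=set0 by exists y1.
have t0 : 0 <= t by exact: dist_to_ge0.
have w0 : 0 <= w by exact: sqrtr_ge0.
have w2 : w ^+ 2 = r ^+ 2 - D ^+ 2 by rewrite sqr_sqrtr // ltW // sqr_gap_gt0.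
have xm : enorm (x - m) ^+ 2 = t ^+ 2 - h2.
  rewrite enormC enorm_midpoint_sqr (enormC y1) (enormC y2) n1 n2 -/h2.
  by field.
have inX z : X z <-> forall p, K p -> r ^+ 2 <= enorm (z - p) ^+ 2.
  rewrite copar_setE //=; split.
    move=> /(le_distP K0) h p Kp.
    by rewrite ler_sqr ?nnegrE ?enorm_ge0 ?(ltW r0) // h.
  move=> h; apply/(le_distP K0) => p Kp.
  by have := h p Kp; rewrite ler_sqr ?nnegrE ?enorm_ge0 ?(ltW r0).
have mp p : K p -> r ^+ 2 - h2 <= enorm (m - p) ^+ 2.
  move=> Kp; rewrite enorm_midpoint_sqr lerD2r.
  have := (inX y1).1 X1 p Kp; have := (inX y2).1 X2 p Kp; lra.
have ht : h2 <= t ^+ 2 by rewrite -subr_ge0 -xm sqr_ge0.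
have tw2 : t ^+ 2 < w ^+ 2 by rewrite ltr_sqr.
(* The displacement [s = w - l] is the positive root of [s ^+ 2 + 2 * s * l = h2]: it gains exactly
   the loss [h2] of the midpoint. *)
pose l := Num.sqrt (w ^+ 2 - h2).
have l2 : l ^+ 2 = w ^+ 2 - h2.
  by rewrite sqr_sqrtr // subr_ge0 (le_trans ht) // ltW.
have l0 : 0 <= l by exact: sqrtr_ge0.
pose s := w - l.
have s0 : 0 < s.
  by rewrite subr_gt0 -ltr_sqr // l2 ltrBlDr ltrDl.
have sl : s ^+ 2 + 2 * s * l = h2.
  by have : h2 = w ^+ 2 - l ^+ 2; [rewrite l2; ring|move=> ->; rewrite /s; ring].
have [x0 Kx0] := K0.
pose a := enorm (m - x0).
have a0 : 0 < a.
  rewrite lt_def enorm_ge0 andbT; apply/eqP => a0.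
  have := mp _ Kx0; rewrite -/a a0 expr0n /=.
  by have := sqr_ge0 D; lra.
pose z := m + (s / a) *: (m - x0).
have sa2 : enorm ((s / a) *: (m - x0)) ^+ 2 = s ^+ 2.
  by rewrite enormZ -/a gtr0_norm ?divr_gt0 // divfK // gt_eqF.
have Xz : X z.
  apply/inX => p Kp; rewrite /z addrAC enormD_sqr sa2 dotZr dot_polar -/a.
  have h1 := mp _ Kp.
  have h2' := sqr_diam_le cK Kx0 Kp.
  (* The numerator is at least [l ^+ 2 + a ^+ 2], since [l ^+ 2 = r ^+ 2 - D ^+ 2 - h2]; AM-GM
     finishes. *)
  have h3 : l * a <=
      (enorm (m - p) ^+ 2 + a ^+ 2 - enorm (x0 - p) ^+ 2) / 2.
    by have := sqr_ge0 (l - a); rewrite sqrrB; lra.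
  have h4 : s * l <= s / a *
      ((enorm (m - p) ^+ 2 + a ^+ 2 - enorm (x0 - p) ^+ 2) / 2).
    have -> : s * l = s / a * (l * a) by rewrite mulrCA divfK ?gt_eqF // mulrC.
    by rewrite ler_pM2l ?divr_gt0.
  by move: h1 h4 sl; lra.
have := dist_to_le x Xz; rewrite -/t leNgt => /negP; apply.
rewrite -ltr_sqr ?nnegrE ?enorm_ge0 // /z opprD addrA enormD_sqr.
rewrite enormN sa2 xm dotNr dotZr.
(* The push adds at most [s ^+ 2 + 2 * s * enorm (x - m)] to the squared distance from [x]. This
   strict inequality makes that less than [h2], so [z] is closer to [x] than [t]. *)
have tl : enorm (x - m) < l.
  by rewrite -ltr_sqr ?nnegrE ?enorm_ge0 // xm l2 ltrD2r.
have := normr_dot_le (x - m) (m - x0); rewrite -/a ler_norml => /andP[h _].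
have h5 : - (s * enorm (x - m)) <= s / a * dot (x - m) (m - x0).
  have -> : - (s * enorm (x - m)) = s / a * (- (enorm (x - m) * a)).
    by rewrite mulrN mulrCA divfK ?gt_eqF // mulrC.
  by rewrite ler_pM2l ?divr_gt0.
have h6 : s * enorm (x - m) < s * l by rewrite ltr_pM2l.
by move: sl h5 h6; lra.
Qed.

Lemma reach_copar : (0 < d)%N -> ((Num.sqrt (r ^+ 2 - D ^+ 2))%:E <= reach X)%E.
Proof.
move=> d0; rewrite /reach le_max; apply/orP; right.
set w := Num.sqrt _; have w0 : 0 < w by rewrite sqrtr_gt0 sqr_gap_gt0.
have [y Xy] : X !=set0.
  by have [y yr] := far_point_ex K0 cK Dr d0; exists y; rewrite copar_setE.
apply/lee_addgt0Pr => e e0; rewrite -leeBlDr // -EFinB.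
(* Uniqueness is known strictly below [w] only. The maximum with [w / 2] keeps the radius positive
   when [e] is large. *)
apply: (@le_trans _ _ (Num.max (w - e) (w / 2))%:E).
  by rewrite lee_fin le_max lexx.
apply: ereal_sup_ubound; exists (Num.max (w - e) (w / 2)) => //; split.
  by rewrite lt_max divr_gt0 // orbT.
move=> x xs.
have [z nz] := nearest_ex x (ex_intro _ y Xy) (@copar_set_closed _ _ _ _).
exists z; split => // z' nz'; apply: nearest_copar_unique nz nz'.
apply: le_lt_trans xs _.
by rewrite gt_max ltrBlDr ltrDl e0 ltr_pdivrMr // ltr_pMr // ltr1n.
Qed.

End Reach.

(** * The boundary as a Lipschitz graph *)

Section LipschitzBoundary.
Variables (R : realType) (d : nat) (K : set 'rV[R]_d) (r : R).
Local Notation E := 'rV[R]_d.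
Hypotheses (K0 : K !=set0) (cK : compact K) (r0 : 0 < r).
Hypothesis Dr : 2 * diam K ^+ 2 <= r ^+ 2.
Implicit Types (x y p n w v : E).
Local Notation D := (diam K).
Local Notation dist := (dist_to K).

Lemma diam_lt_of_sqr : D < r.
Proof.
rewrite -ltr_sqr ?nnegrE ?diam_ge0 ?(ltW r0) //.
by have : 0 < r ^+ 2 by [rewrite exprn_gt0]; move: Dr; nra.
Qed.

Let Dltr := diam_lt_of_sqr.

Definition hyperplane_proj n : 'M[R]_d := 1%:M - n^T *m n.

Lemma mulmx_tr_dot v n : v *m n^T = (dot v n)%:M.
Proof.
apply/matrixP => i j; rewrite !ord1 !mxE eqxx mulr1n.
by apply: eq_bigr => k _; rewrite mxE.
Qed.

Lemma hyperplane_projE n v : v *m hyperplane_proj n = v - dot v n *: n.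
Proof. by rewrite mulmxBr mulmx1 mulmxA mulmx_tr_dot mul_scalar_mx. Qed.

Lemma hyperplane_proj_spec n : enorm n = 1 ->
  [/\ (hyperplane_proj n)^T = hyperplane_proj n,
      hyperplane_proj n *m hyperplane_proj n = hyperplane_proj n &
      \rank (hyperplane_proj n) = d.-1].
Proof.
move=> n1; have nn : n *m n^T = 1%:M.
  by rewrite mulmx_tr_dot -enorm_sqr n1 expr1n.
have nP : n *m hyperplane_proj n = 0.
  by rewrite hyperplane_projE -enorm_sqr n1 expr1n scale1r subrr.
split.
- by rewrite /hyperplane_proj linearB /= trmx1 trmx_mul trmxK.
- by rewrite {1}/hyperplane_proj mulmxBl mul1mx -mulmxA nP mulmx0 subr0.
(* The kernel is the line spanned by [n]; the rank follows by rank-nullity. *)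
- have rk : \rank (kermx (hyperplane_proj n)) = 1%N.
    have n0 : n != 0 by rewrite -enorm_eq0 n1 oner_eq0.
    rewrite -[RHS](_ : \rank n = 1%N); last first.
      by apply/eqP; rewrite eqn_leq rank_leq_row lt0n mxrank_eq0.
    apply/eqmx_rank/andP; split; last by apply/sub_kermxP.
    apply/rV_subP => u /sub_kermxP; rewrite hyperplane_projE => /eqP.
    by rewrite subr_eq0 => /eqP ->; rewrite scalemx_sub.
  have := mxrank_ker (hyperplane_proj n); rewrite rk.
  by have := rank_leq_row (hyperplane_proj n) => h1 h2; lia.
Qed.

(* Below x the set K(r) contains a cone with axis x0 - x, for every x0 in K. *)
Lemma below_cone x x0 w y : dist x = r -> K x0 ->
  let n := (enorm (x - x0))^-1 *: (x - x0) in
  enorm (w - x) < r / 32 -> enorm (y - x) < r / 32 -> dist w <= r ->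
  8 * enorm ((w - y) *m hyperplane_proj n) < dot (w - y) n -> dist y < r.
Proof.
move=> xr Kx0 n wx yx wr h.
pose b := enorm (x - x0).
have rb : r <= b by rewrite -xr /b dist_to_le.
have b0 : 0 < b by exact: lt_le_trans rb.
have n1 : enorm n = 1.
  by rewrite enormZ ger0_norm ?invr_ge0 ?enorm_ge0 // mulVf // gt_eqF.
have [p [Kp wp]] := nearest_ex w K0 (rV_compact_closed cK).
(* By the law of cosines the left factor [n] sees [x - p] with component at least
   [(b ^+ 2 + r ^+ 2 - D ^+ 2) / (2 * b)], hence at least [b / 2]. *)
have np : r / 2 <= dot n (x - p).
  have rp : r ^+ 2 <= enorm (x - p) ^+ 2.
    by rewrite ler_sqr ?nnegrE ?enorm_ge0 ?(ltW r0) // -xr dist_to_le.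
  have dp := sqr_diam_le cK Kx0 Kp.
  rewrite dotC dotZr dot_polar -/b [leRHS]mulrC ler_pdivlMr //.
  have : r * b <= b ^+ 2 by rewrite expr2 ler_pM2r.
  have : 0 < r ^+ 2 by rewrite exprn_gt0.
  by move: Dr rp dp; lra.
set v := w - y in h *; set v' := v *m _ in h; set a := dot v n in h.
have vE : v = v' + a *: n by rewrite /v' hyperplane_projE subrK.
have a0 : 0 < a by apply: le_lt_trans h; rewrite mulr_ge0 ?enorm_ge0.
(* Here 15/32 = 1/2 - 1/32 accounts for the shift from [x] to [w], and below 11/32 = 15/32 - 1/8 for
   the transversal part [v'], which is shorter than [a / 8]. At the end the gain 2 * 11/32 beats the
   quadratic loss 9/8 * 1/16, both in units of [a * r]. *)
have nw : 15%:R * r / 32%:R <= dot n (w - p).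
  have -> : w - p = (w - x) + (x - p) by rewrite addrA subrK.
  rewrite dotDr; have := normr_dot_le n (w - x); rewrite n1 mul1r.
  by rewrite ler_norml => /andP[h1 _]; lra.
have vw : a * (11%:R / 32%:R * r) <= dot v (w - p).
  rewrite vE dotDl dotZl.
  have := normr_dot_le v' (w - p); rewrite ler_norml => /andP[h1 _].
  have h2 : enorm v' * enorm (w - p) <= a / 8 * r.
    by rewrite ler_pM ?enorm_ge0 ?wp //; lra.
  have h3 : a * (15%:R * r / 32%:R) <= a * dot n (w - p) by rewrite ler_pM2l.
  by move: h1 h2 h3; lra.
have va : enorm v <= a * (9%:R / 8%:R).
  rewrite vE; apply: le_trans (ler_enormD _ _) _.
  by rewrite enormZ n1 mulr1 gtr0_norm //; lra.
have vr : enorm v <= r / 16%:R.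
  have -> : v = (w - x) + (x - y) by rewrite addrA subrK.
  by apply: le_trans (ler_enormD _ _) _; rewrite (enormC x); lra.
have v2 : enorm v ^+ 2 <= a * (9%:R / 8%:R) * (r / 16%:R).
  by rewrite expr2 ler_pM ?enorm_ge0.
apply: le_lt_trans (dist_to_le _ Kp) _.
rewrite -ltr_sqr ?nnegrE ?enorm_ge0 ?(ltW r0) //.
have -> : y - p = (w - p) + - v by rewrite /v opprB addrAC addrCA subrr addr0 addrC.
rewrite enormD_sqr enormN dotNr (dotC _ v).
have : enorm (w - p) ^+ 2 <= r ^+ 2.
  by rewrite ler_sqr ?nnegrE ?enorm_ge0 ?(ltW r0) // wp.
have : 0 < a * r by rewrite mulr_gt0.
by move: v2 vw; lra.
Qed.

(** Near [x] a point strictly under the cone of some point of K(r) has distance below [r] to [K],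
    and a point of K(r) is under its own cone. So the boundary is the graph, over the hyperplane
    orthogonal to [n], of the upper envelope of these cones. *)
Lemma frontier_lipschitz :
  lipschitz_submanifold d.-1 (frontier (parallel_set K r)).
Proof.
rewrite (frontierE K0 cK r0 Dltr) => x /= xr.
have [x0 Kx0] := K0.
pose eta := r / 32; pose n := (enorm (x - x0))^-1 *: (x - x0).
have eta0 : 0 < eta by rewrite divr_gt0.
have b0 : 0 < enorm (x - x0) by apply: lt_le_trans r0 _; rewrite -xr dist_to_le.
have n1 : enorm n = 1.
  by rewrite enormZ ger0_norm ?invr_ge0 ?enorm_ge0 // mulVf // gt_eqF.
pose P := hyperplane_proj n.
have nP : n *m P = 0.
  by rewrite hyperplane_projE -enorm_sqr n1 expr1n scale1r subrr.
have PE v : v *m P = v - dot v n *: n by exact: hyperplane_projE.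
pose A : set E := [set w | dist w <= r /\ enorm (w - x) < eta].
(* The heights over [z] of the downward cones of slope 8 with apex in [A]; their supremum [h]
   inherits the Lipschitz constant. *)
pose S (z : E) := [set dot w n - 8 * enorm (z - w *m P) | w in A].
have Sub z : has_ubound (S z).
  exists (enorm x + eta) => _ [w [_ wx] <-].
  have h1 := dot_le_enorm w n; rewrite n1 mulr1 in h1.
  have h2 := ler_enormB w x; have h3 := enorm_ge0 (z - w *m P).
  by move: wx; lra.
have Ax : A x by split; rewrite ?xr // subrr enorm0.
have Sne z : S z !=set0 by exists (dot x n - 8 * enorm (z - x *m P)), x.
pose h z := sup (S z).
have hge z w : A w -> dot w n - 8 * enorm (z - w *m P) <= h z.
  by move=> Aw; apply: ub_le_sup => //; exists w.
have hlip z z' : h z - h z' <= 8 * enorm (z - z').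
  rewrite lerBlDl; apply: ge_sup => // _ [w Aw <-].
  have := hge z' w Aw; have := ler_enormD (z - w *m P) (z' - z).
  have -> : z - w *m P + (z' - z) = z' - w *m P by rewrite addrC addrA subrK.
  by rewrite (enormC z'); lra.
have hgt z c : c < h z -> exists2 w, A w & c < dot w n - 8 * enorm (z - w *m P).
  by move=> /sup_gt => /(_ (Sne z)) [_ [w Aw <-] cw]; exists w.
have below y w : A w -> enorm (y - x) < eta ->
    dot y n < dot w n - 8 * enorm (y *m P - w *m P) -> dist y < r.
  move=> [wr wx] yx yw; apply: (below_cone xr Kx0 wx yx wr).
  rewrite -/n -/P mulmxBl (enormC (w *m P)) dotDl dotNl; lra.
exists [set y | enorm (y - x) < eta], P, (fun z => h z *: n), 8; split.
- split; last by rewrite /= subrr enorm0.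
  move=> y /= yx; apply/nbhs_enormP; exists (eta - enorm (y - x)).
    by rewrite subr_gt0.
  move=> z yz; rewrite /=; have := ler_enormD (z - y) (y - x).
  by rewrite addrA subrK (enormC z y); move: yz; lra.
- exact: hyperplane_proj_spec.
- by move=> y; rewrite -scalemxAl nP scaler0.
- move=> y z; rewrite -scalerBl enormZ n1 mulr1 ler_norml hlip andbT.
  by rewrite lerNl opprB enormC hlip.
have nn : dot n n = 1 by rewrite -enorm_sqr n1 expr1n.
have n0 : n != 0 by rewrite -enorm_eq0 n1 oner_eq0.
have tn t : 0 < t -> enorm (t *: n) = t.
  by move=> t0; rewrite enormZ n1 mulr1 gtr0_norm.
apply/seteqP; split => y /=.
  move=> [yr yx]; split => //; rewrite {1}PE subKr; congr (_ *: _).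
  have Ay : A y by split; rewrite ?yr.
  apply/eqP; rewrite eq_le; apply/andP; split.
    have := hge (y *m P) y Ay.
    by rewrite subrr enorm0 mulr0 subr0.
  rewrite leNgt; apply/negP => /hgt[w Aw yw].
  by have := below y w Aw yx yw; rewrite yr ltxx.
move=> [yx]; rewrite {1}PE subKr => /eqP.
rewrite -subr_eq0 -scalerBl scaler_eq0 (negbTE n0) orbF subr_eq0 => /eqP yh.
split => //.
apply/eqP; rewrite eq_le !leNgt; apply/andP; split; apply/negP => yr.
  (* Lowering [y] by [t] puts it strictly under a cone, hence at distance below [r]; but [t] is too
     small for the 1-Lipschitz distance to drop that far. Halving makes both bounds on [t]
     strict. *)
  pose t := Num.min (dist y - r) (eta - enorm (y - x)) / 2.
  have t0 : 0 < t by rewrite divr_gt0 // lt_min !subr_gt0 yr.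
  have [t1 t2] : t < dist y - r /\ t < eta - enorm (y - x).
    apply/andP; rewrite -lt_min /t ltr_pdivrMr // ltr_pMr ?ltr1n //.
    by rewrite lt_min !subr_gt0 yr.
  have [w Aw wt] : exists2 w, A w &
      h (y *m P) - t < dot w n - 8 * enorm (y *m P - w *m P).
    by apply: hgt; rewrite ltrBlDr ltrDl.
  have e1 : (y - t *: n) *m P = y *m P.
    by rewrite mulmxBl -scalemxAl nP scaler0 subr0.
  have : dist (y - t *: n) < r.
    apply: (below _ w) => //.
      rewrite addrAC; apply: le_lt_trans (ler_enormD _ _) _.
      by rewrite enormN tn //; move: t2; lra.
    by rewrite e1 dotDl dotNl dotZl nn mulr1 yh.
  have := dist_to_lipschitz y (y - t *: n) K0.
  by rewrite opprB addrCA subrr addr0 tn //; move: t1; lra.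
(* Raising [y] by [t] keeps it in [A], so [h] would exceed its own value by [t]. *)
pose t := Num.min (r - dist y) (eta - enorm (y - x)) / 2.
have t0 : 0 < t by rewrite divr_gt0 // lt_min !subr_gt0 yr.
have [t1 t2] : t < r - dist y /\ t < eta - enorm (y - x).
  apply/andP; rewrite -lt_min /t ltr_pdivrMr // ltr_pMr ?ltr1n //.
  by rewrite lt_min !subr_gt0 yr.
have e1 : (y + t *: n) *m P = y *m P.
  by rewrite mulmxDl -scalemxAl nP scaler0 addr0.
have Ay : A (y + t *: n).
  split.
    have := dist_to_lipschitz (y + t *: n) y K0.
    by rewrite addrAC subrr add0r tn //; move: t1; lra.
  rewrite addrAC; apply: le_lt_trans (ler_enormD _ _) _.
  by rewrite tn //; move: t2; lra.
have := hge (y *m P) _ Ay; rewrite e1 subrr enorm0 mulr0 subr0 dotDl dotZl nn.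
by rewrite -yh mulr1 gerDl leNgt t0.
Qed.

End LipschitzBoundary.

(** * Volume *)

Section ErealSup.
Variable R : realType.
Implicit Types S : set (\bar R).
Local Open Scope ereal_scope.

Lemma ereal_sup_addr_le S y c : S !=set0 -> (forall x, S x -> 0 <= x) ->
  0 <= y -> (forall x, S x -> x + y <= c) -> ereal_sup S + y <= c.
Proof.
move=> [x0 Sx0] S0; case: y => [y||] // y0 h.
  by rewrite -leeBrDr //; apply/ereal_supP => x Sx; rewrite leeBrDr // h.
have := h _ Sx0; rewrite addey ?leye_eq => [/eqP ->|]; first exact: leey.
by rewrite gt_eqF // (lt_le_trans _ (S0 _ Sx0)).
Qed.

(** Nonnegativity excludes sums of opposite infinities. This serves both the lower integral and the
    Hausdorff measure, which are suprema. *)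
Lemma ereal_sup_add_le S1 S2 c : S1 !=set0 -> S2 !=set0 ->
  (forall x, S1 x -> 0 <= x) -> (forall x, S2 x -> 0 <= x) ->
  (forall x y, S1 x -> S2 y -> x + y <= c) -> ereal_sup S1 + ereal_sup S2 <= c.
Proof.
move=> n1 n2 h1 h2 h; apply: ereal_sup_addr_le => //.
  by have [y Sy] := n2; apply: le_trans (h2 _ Sy) (ereal_sup_ubound Sy).
move=> x Sx; rewrite addeC; apply: ereal_sup_addr_le => //; first exact: h1.
by move=> y Sy; rewrite addeC; exact: h.
Qed.

End ErealSup.

Section LowerIntegral.
Context d (T : measurableType d) (R : realType).
Variable mu : {measure set T -> \bar R}.
Implicit Types f g : T -> \bar R.
Local Open Scope ereal_scope.
Import HBNNSimple.

(* The library integral of a nonnegative function is a supremum over simple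
   functions, hence monotone and superadditive without measurability. *)
Lemma le_integral_nonmeas f g : (forall x, 0 <= f x) -> (forall x, f x <= g x) ->
  \int[mu]_x f x <= \int[mu]_x g x.
Proof.
move=> f0 fg; have g0 x : 0 <= g x by exact: le_trans (f0 x) (fg x).
rewrite !ge0_integralTE //; apply: ereal_sup_le => _ [h /= hf <-].
by exists h => //= x; exact: le_trans (hf x) (fg x).
Qed.

Lemma integralD_superadditive f g :
  (forall x, 0 <= f x) -> (forall x, 0 <= g x) ->
  \int[mu]_x f x + \int[mu]_x g x <= \int[mu]_x (f x + g x).
Proof.
move=> f0 g0; have fg0 x : 0 <= f x + g x by rewrite adde_ge0.
rewrite !ge0_integralTE //; apply: ereal_sup_add_le.
- by exists (sintegral mu (@nnsfun0 _ T R)), nnsfun0.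
- by exists (sintegral mu (@nnsfun0 _ T R)), nnsfun0.
- by move=> _ [h /= _ <-]; exact: sintegral_ge0.
- by move=> _ [h /= _ <-]; exact: sintegral_ge0.
move=> _ _ [h1 /= h1f <-] [h2 /= h2g <-]; rewrite -sintegralD.
apply: ereal_sup_ubound; exists (add_nnsfun h1 h2) => //= x.
by rewrite EFinD leeD.
Qed.

End LowerIntegral.

Section Volume.
Variable R : realType.

Local Open Scope ereal_scope.

Lemma vol_ge0 d (A : set 'rV[R]_d) : 0 <= vol A.
Proof.
elim: d A => [|d IH] A /=; first by rewrite lee_fin.
by apply: integral_ge0 => t _; exact: IH.
Qed.

Lemma le_vol d (A B : set 'rV[R]_d) : A `<=` B -> vol A <= vol B.
Proof.
elim: d A B => [|d IH] A B AB /=.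
  rewrite lee_fin /indic ler_nat.
  by case: (boolP (0%R \in A)) => // /set_mem /AB /mem_set ->.
apply: le_integral_nonmeas => t; first exact: vol_ge0.
by apply: IH => v /=; exact: AB.
Qed.

Lemma vol_set0 d : vol (set0 : set 'rV[R]_d) = 0.
Proof.
elim: d => [|d IH] /=; first by rewrite indic0.
by apply: integral0_eq => t _; exact: IH.
Qed.

(** Superadditivity holds for arbitrary disjoint sets and is what packing disjoint sets into K(r)
    requires. *)
Lemma vol_superadditive d (A B : set 'rV[R]_d) : A `&` B = set0 ->
  vol A + vol B <= vol (A `|` B).
Proof.
elim: d A B => [|d IH] A B AB /=.
  rewrite -EFinD lee_fin /indic in_setU.
  have := AB; rewrite -subset0 => /(_ 0%R).
  case: (boolP (0%R \in A)) => [/set_mem a|_];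
    case: (boolP (0%R \in B)) => [/set_mem b|_] //=.
  - by move=> /(_ (conj a b)).
  - by rewrite addr0.
  - by rewrite add0r.
  - by rewrite addr0.
apply: le_trans (integralD_superadditive _ _ _) _; try by move=> t; exact: vol_ge0.
apply: le_integral_nonmeas => t; first by rewrite adde_ge0 ?vol_ge0.
apply: IH; rewrite -subset0 => v /= [a b].
by have := AB; rewrite -subset0; apply; split; [exact: a|exact: b].
Qed.

Lemma sum_vol_le d n (F : 'I_n -> set 'rV[R]_d) (B : set 'rV[R]_d) :
  trivIset setT F -> (forall i, F i `<=` B) -> \sum_(i < n) vol (F i) <= vol B.
Proof.
elim: n F B => [|n IH] F B tF FB; first by rewrite big_ord0 vol_ge0.
rewrite big_ord_recl.
apply: (@le_trans _ _ (vol (F ord0) + vol (B `\` F ord0))).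
  rewrite leeD2l //; apply: IH.
    move=> i j _ _ ij; apply: (@lift_inj _ ord0); exact: tF ij.
  move=> i x Fx; split; first exact: FB Fx.
  move=> F0x; have := tF ord0 (lift ord0 i) I I; move/(_ (ex_intro _ x (conj F0x Fx))).
  by move/eqP; rewrite (negbTE (neq_lift _ _)).
apply: le_trans (vol_superadditive _) _.
  by rewrite setDE setICA setICr setI0.
by apply: le_vol => x [|[]//]; exact: FB.
Qed.

Definition cube d (c : 'rV[R]_d) (M : R) : set 'rV[R]_d :=
  [set v | forall i, (`|v ord0 i - c ord0 i| <= M)%R].

Lemma vol_cube d (c : 'rV[R]_d) (M : R) : (0 <= M)%R ->
  vol (cube c M) = ((2 * M) ^+ d)%:E.
Proof.
move=> M0; elim: d c => [|d IH] c /=.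
  by rewrite expr0 indicE mem_set // => -[].
pose c1 : 'rV[R]_(1 + d) := c.
pose a : R := c1 ord0 (lshift d ord0).
pose c' : 'rV[R]_d := \row_j c1 ord0 (rshift 1 j).
(* A section of the cube is a cube of one dimension less or empty, according to whether [t] lies in
   the interval around the first coordinate of the centre. *)
have secE t :
    vol [set v : 'rV[R]_d | cube c1 M (row_mx (t%:M : 'rV[R]_1) v : 'rV[R]_(1 + d))] =
    (((2 * M) ^+ d)%:E * (\1_(`[a - M, a + M]%classic) t)%:E).
  have itvE : (a - M <= t <= a + M)%R = (`|t - a| <= M)%R.
    by rewrite ler_norml [in RHS]lerBlDl [in RHS]lerBrDl.
  have [tM|tM] := leP `|t - a|%R M.
    rewrite indicE mem_set ?mule1; last by rewrite /= in_itv /= itvE.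
    rewrite -(IH c'); congr vol; apply/seteqP; split => v /= h i.
      by have := h (rshift 1 i); rewrite row_mxEr mxE.
    case: (split_ordP i) => j ->; first by rewrite (ord1 j) row_mxEl mxE eqxx.
    by rewrite row_mxEr; have := h j; rewrite mxE.
  rewrite indicE memNset ?mule0; last by rewrite /= in_itv /= itvE leNgt tM.
  rewrite -(vol_set0 d); congr vol; rewrite -subset0 => v /= /(_ (lshift d ord0)).
  by rewrite row_mxEl mxE eqxx leNgt tM.
under eq_integral do rewrite secE.
rewrite ge0_integralZl //=; last 2 first.
- exact/measurable_EFinP/measurable_indic.
- by rewrite lee_fin exprn_ge0 // mulr_ge0.
rewrite integral_indic //= setIT.
rewrite lebesgue_measure_itv /= lte_fin; case: ifPn => h.
  rewrite -EFinB -EFinM; congr (_%:E); rewrite exprS; ring.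
have -> : M = 0%R by apply/eqP; rewrite eq_le M0 andbT; move: h; rewrite -leNgt; lra.
by rewrite mule0 mulr0 exprS mul0r.
Qed.

Lemma vol_ball_le d (A : set 'rV[R]_d) (c : 'rV[R]_d) (M : R) : (0 <= M)%R ->
  (forall x, A x -> (enorm (x - c) <= M)%R) -> vol A <= ((2 * M) ^+ d)%:E.
Proof.
move=> M0 h; rewrite -(vol_cube c M0); apply: le_vol => x Ax i.
by have := coord_le_enorm (x - c) i; rewrite !mxE => /le_trans; apply; exact: h.
Qed.

Lemma omega_gt0 j : (0 < omega R j)%R.
Proof.
rewrite /omega; apply: fine_gt0; apply/andP; split.
  (* A cube inside the unit ball gives positivity; a cube around it gives the finiteness without
     which [fine] would return 0. *)
  apply: (@lt_le_trans _ _ (vol (@cube j 0%R (j.+1%:R^-1)))).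
    by rewrite vol_cube // lte_fin exprn_gt0 // mulr_gt0.
  apply: le_vol => x xc /=.
  apply: (@le_trans _ _ ((j.+1%:R^-1 : R) *+ j)%R).
    by apply: enorm_le_coord => i; have := xc i; rewrite mxE subr0.
  by rewrite -[leLHS]mulr_natr mulrC ler_pdivrMr // mul1r ler_nat.
apply: (@le_lt_trans _ _ ((2 * 1) ^+ j)%:E); last by rewrite ltry.
by apply: (@vol_ball_le _ _ 0%R) => // x; rewrite /= subr0.
Qed.

End Volume.

(** * Curvature measures *)

(** The weights form column [i0] of the inverse Vandermonde matrix. They recover the coefficient of
    index [i0] of a polynomial of degree below [n] from its values at the nodes. *)
Lemma vandermonde_weights (F : fieldType) (n : nat) (t : 'I_n -> F) (i0 : 'I_n) :
  injective t ->
  exists a : 'I_n -> F, forall i : 'I_n, \sum_j a j * t j ^+ i = (i == i0)%:R.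
Proof.
move=> tI; pose V := Vandermonde n (\row_j t j).
have Vu : V \in unitmx.
  rewrite unitmxE det_Vandermonde unitfE; apply/prodf_neq0 => i _.
  apply/prodf_neq0 => j ij; rewrite !mxE subr_eq0.
  by apply/eqP => /tI e; rewrite e ltnn in ij.
exists (fun j => invmx V j i0) => i.
have := mulmxV Vu; move/matrixP/(_ i i0); rewrite [LHS]mxE [RHS]mxE => <-.
by apply: eq_bigr => j _; rewrite !mxE mulrC.
Qed.

Lemma sub_bounded (R : realType) (V : normedModType R) (A B : set V) :
  A `<=` B -> bounded_set B -> bounded_set A.
Proof.
by move=> AB [M [Mr h]]; exists M; split=> // N MN x /AB; exact: h.
Qed.

Section Borel.
Variables (R : realType) (d : nat).
Local Notation E := 'rV[R]_d.
Local Notation bT := (g_sigma_algebraType [set A : set E | open A]).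

Lemma borel_closed (A : set E) : closed A -> borel A.
Proof.
move=> cA; rewrite -(setCK A).
apply: (@measurableC _ bT); apply: sub_sigma_algebra => /=.
exact: closed_openC.
Qed.

Lemma borelI (A B : set E) : borel A -> borel B -> borel (A `&` B).
Proof. exact: (@measurableI _ bT). Qed.

Lemma borelD (A B : set E) : borel A -> borel B -> borel (A `\` B).
Proof. exact: (@measurableD _ bT). Qed.

Lemma borel_set0 : borel (set0 : set E).
Proof. exact: (@measurable0 _ bT). Qed.

Lemma signed_measureU (mu : set E -> R) (A B : set E) : signed_measure mu ->
  borel A -> borel B -> A `&` B = set0 -> bounded_set (A `|` B) ->
  mu (A `|` B) = mu A + mu B.
Proof.
move=> [mu0 muS] bA bB AB bAB.
have h1 : \sum_(0 <= i < n) mu (bigcup2 A B i) @[n --> \oo] --> mu (A `|` B).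
  rewrite -bigcup2E; apply: muS; last by rewrite bigcup2E.
    by move=> [|[|i]] /=; rewrite ?bA ?bB //; exact: borel_set0.
  by rewrite -trivIset_bigcup2.
have h2 : \sum_(0 <= i < n) mu (bigcup2 A B i) @[n --> \oo] --> mu A + mu B.
  apply: cvg_near_cst; exists 2 => // n /= n2.
  rewrite (big_cat_nat (n := 2)) //= big_nat_recl // big_nat1 /=.
  by rewrite big_nat_cond big1 ?addr0 // => -[|[|i]] //=.
by rewrite -(cvg_lim (@Rhausdorff R) h1) (cvg_lim (@Rhausdorff R) h2).
Qed.

End Borel.

Section CurvatureBound.
Variables (R : realType) (d : nat) (K : set 'rV[R]_d) (r : R).
Local Notation E := 'rV[R]_d.
Hypotheses (d0 : (0 < d)%N) (K0 : K !=set0) (cK : compact K) (r0 : 0 < r).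
Hypothesis Dr : 2 * diam K ^+ 2 <= r ^+ 2.
Local Notation D := (diam K).
Local Notation X := (copar_set K r).
Local Notation S := (frontier (parallel_set K r)).
Local Notation dist := (dist_to K).

Let Dltr : D < r := diam_lt_of_sqr r0 Dr.

Lemma parallel_set_ball x0 x : K x0 -> parallel_set K r x -> enorm (x - x0) <= 2 * r.
Proof.
move=> Kx0; rewrite /parallel_set /= => xr.
have [p [Kp xp]] := nearest_ex x K0 (rV_compact_closed cK).
have -> : x - x0 = (x - p) + (p - x0) by rewrite addrA subrK.
apply: le_trans (ler_enormD _ _) _; rewrite xp.
by have := diam_bounded (compact_enorm_bounded cK) Kp Kx0; move: Dltr; lra.
Qed.

Lemma vol_parallel_le : (vol (parallel_set K r) <= ((4 * r) ^+ d)%:E)%E.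
Proof.
have [x0 Kx0] := K0.
have -> : 4 * r = 2 * (2 * r) by ring.
apply: (vol_ball_le (c := x0)); first by rewrite mulr_ge0 // ltW.
by move=> x; exact: parallel_set_ball.
Qed.

(** Since [r ^+ 2 - D ^+ 2] is at least [r ^+ 2 / 2], the Steiner formula is available on an
    interval proportional to [r]. *)
Lemma half_lt_reach : ((r / 2)%:E < reach X)%E.
Proof.
apply: lt_le_trans (reach_copar K0 cK r0 Dltr d0); rewrite lte_fin.
rewrite -ltr_sqr ?nnegrE ?sqrtr_ge0 ?divr_ge0 ?(ltW r0) //.
rewrite sqr_sqrtr ?ltW ?sqr_gap_gt0 // expr_div_n.
have : 0 < r ^+ 2 by rewrite exprn_gt0.
by rewrite (_ : 2 ^+ 2 = 4%:R :> R) -?natrX //; move: Dr; lra.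
Qed.

Let X0 : X !=set0.
Proof.
by have [y yr] := far_point_ex K0 cK Dltr d0; exists y; rewrite copar_setE.
Qed.

Lemma frontier_sub_parallel : S `<=` parallel_set K r.
Proof. by rewrite frontierE // => x /= xr; rewrite /parallel_set /= xr. Qed.

Lemma borel_frontier : borel S.
Proof.
apply: borel_closed; rewrite frontierE //.
apply: (@closed_comp _ _ dist [set t | t = r]); last exact: closed_eq.
by move=> y _; exact: dist_to_continuous.
Qed.

Lemma metric_proj_id x : X x -> metric_proj X x = x.
Proof.
move=> Xx; have [_ h] := metric_projP x X0 (@copar_set_closed _ _ _ _).
apply/eqP; rewrite eq_sym -subr_eq0 -enorm_eq0 h eq_le dist_to_ge0 // andbT.
by rewrite (le_trans (dist_to_le x Xx)) // subrr enorm0.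
Qed.

Lemma metric_proj_frontier x : ~ X x -> S (metric_proj X x).
Proof.
set y := metric_proj X x.
have [Xy xy] : nearest X x y := metric_projP x X0 (@copar_set_closed _ _ _ _).
move=> nXx; rewrite frontierE //=; apply/eqP; rewrite eq_le.
move: (Xy); rewrite copar_setE //= => ->; rewrite andbT leNgt.
apply/negP => ry; have xy0 : 0 < enorm (x - y).
  by rewrite enorm_gt0 subr_eq0; apply: contra_notN nXx => /eqP ->.
(* A move from [y] towards [x] of length at most [dist y - r] stays in [X] and would come closer to
   [x]; the cap at 1 prevents overshooting [x]. *)
pose s := Num.min 1 ((dist y - r) / enorm (x - y)).
have s0 : 0 < s by rewrite lt_min ltr01 divr_gt0 // subr_gt0.
have s1 : s <= 1 by rewrite ge_min lexx.
have Xz : X (y + s *: (x - y)).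
  rewrite copar_setE //=; have := dist_to_lipschitz y (y + s *: (x - y)) K0.
  have : enorm (s *: (x - y)) <= dist y - r.
    by rewrite enormZ gtr0_norm // -ler_pdivlMr // ge_min lexx orbT.
  by rewrite opprD addrA subrr add0r enormN; lra.
have := dist_to_le x Xz; rewrite -xy.
have -> : x - (y + s *: (x - y)) = (1 - s) *: (x - y).
  by rewrite scalerBl scale1r opprD addrA.
rewrite enormZ ger0_norm ?subr_ge0 // leNgt => /negP; apply.
by rewrite gtr_pMl // gtrBl.
Qed.

Let A (e : R) (B : set E) := [set x | parallel_set X e x /\ B (metric_proj X x)].

(** Points outside [X] project to [S], so only points of [X], which are fixed by the projection, can
    project off [S]. The right-hand side is free of [e]. *)
Lemma local_parallel_offD e B : 0 < e -> A e (B `\` S) = X `&` (B `\` S).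
Proof.
move=> e0; apply/seteqP; split => x.
  move=> [_ xB]; have [Xx|nXx] := pselect (X x).
    by rewrite metric_proj_id // in xB.
  by case: xB => _; have := metric_proj_frontier nXx.
move=> [Xx xB]; split; last by rewrite metric_proj_id.
rewrite /parallel_set /=; apply: le_trans (dist_to_le x Xx) _.
by rewrite subrr enorm0 ltW.
Qed.

Lemma local_parallel_frontier e B : A e (B `&` S) `<=` parallel_set K r.
Proof.
move=> x [_ [_ xS]]; have [Xx|nXx] := pselect (X x).
  by apply: frontier_sub_parallel; rewrite metric_proj_id in xS.
move: nXx; rewrite copar_setE // /parallel_set /=.
by move/negP; rewrite -ltNge; exact: ltW.
Qed.

Lemma curvature_sum_le (k : 'I_d.+1) (t a : 'I_d.+1 -> R)
    (C : nat -> set E -> R) (n : nat) (F : 'I_n -> set E) :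
  (k < d)%N -> (forall j, 0 < t j <= 2^-1) ->
  (forall i : 'I_d.+1, \sum_j a j * t j ^+ i = (i == rev_ord k)%:R) ->
  is_curvature_measures X C ->
  (forall i, borel (F i) /\ bounded_set (F i)) -> trivIset setT F ->
  \sum_(i < n) `|C k (F i)| <=
    (\sum_j `|a j|) * 4 ^+ d / omega R (d - k) * r ^+ k.
Proof.
move=> kd t01 aP [Cs CP] bF tF.
pose eps j := r * t j.
have eps0 j : 0 < eps j by rewrite mulr_gt0 //; case/andP: (t01 j).
have epsr j : ((eps j)%:E < reach X)%E.
  apply: le_lt_trans half_lt_reach; rewrite lee_fin ler_pM2l //.
  by case/andP: (t01 j).
pose m j B := fine (vol (A (eps j) B)).
have mE j B : borel B -> bounded_set B ->
    vol (A (eps j) B) = (m j B)%:E.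
  by move=> bB bdB; rewrite /m CP.
(* At [eps j = r * t j] the Steiner formula is a polynomial in [t j]; the weights keep the
   coefficient of exponent [d - k], which is the value of [rev_ord k]. *)
have key B : borel B -> bounded_set B ->
    \sum_j a j * m j B = omega R (d - k) * r ^+ (d - k) * C k B.
  move=> bB bdB.
  have -> : \sum_j a j * m j B = \sum_j \sum_(i < d.+1)
      omega R (d - i) * r ^+ (d - i) * C i B * (a j * t j ^+ (d - i)).
    apply: eq_bigr => j _; rewrite /m CP //= mulr_sumr.
    by apply: eq_bigr => i _; rewrite exprMn; ring.
  rewrite exchange_big /= (bigD1 k) //= -mulr_sumr.
  have e (i : 'I_d.+1) : \sum_j a j * t j ^+ (d - i) = (i == k)%:R.
    by have := aP (rev_ord i); rewrite /= subSS => ->; rewrite (inj_eq rev_ord_inj).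
  rewrite e eqxx mulr1 big1 ?addr0 // => i ik.
  by rewrite -mulr_sumr e (negbTE ik) mulr0.
have om : 0 < omega R (d - k) * r ^+ (d - k) by rewrite mulr_gt0 ?omega_gt0 ?exprn_gt0.
(* Off [S] the volumes do not depend on [j], and the weights sum to 0 because [d - k] is a nonzero
   exponent. *)
have off B : borel B -> bounded_set B -> C k (B `\` S) = 0.
  move=> bB bdB; have bB' := borelD bB borel_frontier.
  have bdB' : bounded_set (B `\` S) by exact: sub_bounded (@subDsetl _ _ _) bdB.
  have := key _ bB' bdB'.
  under eq_bigr do rewrite /m local_parallel_offD //.
  rewrite -mulr_suml; have := aP ord0; under eq_bigr do rewrite expr0 mulr1.
  move=> ->; rewrite -val_eqE /= subSS [_ == _]ltn_eqF ?subn_gt0 // mul0r.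
  by move/esym/eqP; rewrite mulf_eq0 gt_eqF //= => /eqP.
have CFE i : C k (F i) = C k (F i `&` S).
  have [bFi bdFi] := bF i.
  rewrite -{1}(setUIDK (F i) S) signed_measureU ?off ?addr0 //.
  - by apply: Cs; rewrite ltnW.
  - exact: borelI bFi borel_frontier.
  - exact: borelD bFi borel_frontier.
  - by rewrite setDE setIACA setICr setI0.
  - by rewrite setUIDK.
have m0 j B : 0 <= m j B by rewrite fine_ge0 // vol_ge0.
(* Disjoint sets have disjoint preimages under the projection, and those over [S] lie in K(r). *)
have mS j : \sum_(i < n) m j (F i `&` S) <= (4 * r) ^+ d.
  rewrite -lee_fin -sumEFin; under eq_bigr => i _.
    rewrite -mE; last 2 first.
    - exact: borelI (bF i).1 borel_frontier.
    - exact: sub_bounded (@subIsetl _ _ _) (bF i).2.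
    over.
  apply: le_trans vol_parallel_le; apply: sum_vol_le.
    move=> i i' _ _ [x [[_ [h1 _]] [_ [h2 _]]]]; apply: (tF i i' I I).
    by exists (metric_proj X x).
  by move=> i; exact: local_parallel_frontier.
rewrite -(ler_pM2l om) mulr_sumr.
apply: (@le_trans _ _ (\sum_(i < n) \sum_j `|a j| * m j (F i `&` S))).
  apply: ler_sum => i _; rewrite CFE -[X in X * `|_|](gtr0_norm om) -normrM -key.
  - apply: le_trans (ler_norm_sum _ _ _) _.
    by apply: ler_sum => j _; rewrite normrM (ger0_norm (m0 _ _)).
  - exact: borelI (bF i).1 borel_frontier.
  - exact: sub_bounded (@subIsetl _ _ _) (bF i).2.
rewrite exchange_big /=.
apply: (@le_trans _ _ (\sum_j `|a j| * (4 * r) ^+ d)).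
  by apply: ler_sum => j _; rewrite -mulr_sumr ler_wpM2l.
rewrite -mulr_suml exprMn.
have -> : r ^+ d = r ^+ (d - k) * r ^+ k by rewrite -exprD subnK // ltnW.
rewrite le_eqVlt; apply/orP; left; apply/eqP.
have : omega R (d - k) != 0 by rewrite gt_eqF // omega_gt0.
by move=> ?; field.
Qed.

End CurvatureBound.

(** * Hausdorff measure *)

Section MetricOuterMeasure.
Variables (R : realType) (d : nat).
Local Notation E := 'rV[R]_d.
Variable mu : {outer_measure set E -> \bar R}.
Local Open Scope ereal_scope.
Hypothesis mu_metric : forall (A B : set E) (eta : R), (0 < eta)%R ->
  (forall a b, A a -> B b -> (eta <= enorm (a - b))%R) ->
  mu A + mu B <= mu (A `|` B).

Section ClosedSet.
Variables (A X : set E).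
Hypotheses (A0 : A !=set0) (cA : closed A).

(** The indices are shifted so that [far n.+1] and the rings of index at least [n] together make up
    the part of [X] off the closed set [A]. *)
Let far n := [set x | X x /\ (n.+1%:R^-1 <= dist_to A x)%R].
Let ring n := [set x | X x /\ (n.+3%:R^-1 <= dist_to A x < n.+2%:R^-1)%R].

Lemma enorm_ge_dist_gap (a b : R) x y :
  (a <= dist_to A x)%R -> (dist_to A y <= b)%R -> (a - b <= enorm (x - y))%R.
Proof. by move=> ax yb; have := dist_to_lipschitz x y A0; lra. Qed.

Lemma ltr_inv_nat m n : (m < n)%N -> (n.+1%:R^-1 < m.+1%:R^-1 :> R)%R.
Proof. by move=> mn; rewrite ltf_pV2 ?posrE // ltr_nat. Qed.

(* Rings of equal parity are at positive distance from each other. *)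
Lemma sum_rings_le c n : \sum_(k < n) mu (ring (k.*2 + c)) <= mu X.
Proof.
suff h : \sum_(k < n) mu (ring (k.*2 + c)) <= mu (far (n.*2 + c)).
  by apply: (le_trans h); apply: le_outer_measure => x [].
elim: n => [|n IH]; first by rewrite big_ord0 outer_measure_ge0.
rewrite big_ord_recr /=; apply: le_trans (leeD2r _ IH) _.
set m := (n.*2 + c)%N.
have gap := ltr_inv_nat (ltnSn m).
apply: (@le_trans _ _ (mu (far m `|` ring m))).
  apply: (mu_metric (eta := m.+1%:R^-1 - m.+2%:R^-1)); first by rewrite subr_gt0.
  by move=> a b [_ am] [_ /andP[_ /ltW bm]]; exact: enorm_ge_dist_gap.
rewrite doubleS !addSn -/m; apply: le_outer_measure => x /=.
move=> [[Xx xd]|[Xx /andP[xd _]]] //.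
split=> //; apply: le_trans xd; apply/ltW/ltr_inv_nat; lia.
Qed.

(** The set [far n.+1] is at positive distance from [A], so [mu] is superadditive on it and [X]
    intersected with [A]. What remains of [X] is covered by rings, whose total measure is the tail
    of a convergent series. *)
Lemma caratheodory_closed_le : mu (X `&` A) + mu (X `&` ~` A) <= mu X.
Proof.
have [->|muX] := eqVneq (mu X) +oo; first exact: leey.
have muXfin : mu X \is a fin_num by rewrite ge0_fin_numE ?outer_measure_ge0 // ltey.
have le_muX B : B `<=` X -> mu B \is a fin_num.
  move=> BX; rewrite ge0_fin_numE ?outer_measure_ge0 //.
  by apply: le_lt_trans (le_outer_measure mu _ _ BX) _; rewrite ltey.
set s := \sum_(k <oo) mu (ring k).
(* Even and odd rings contribute at most [mu X] each. *)
have s_le : s <= mu X + mu X.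
  apply: lime_le; first by apply: is_cvg_nneseries => k _ _; exact: outer_measure_ge0.
  apply: nearW => n.
  apply: (@le_trans _ _ (\sum_(0 <= k < n.*2) mu (ring k))).
    apply: lee_sum_nneg_natr => //; last by rewrite -addnn leq_addr.
  have -> : \sum_(0 <= k < n.*2) mu (ring k) =
     \sum_(k < n) mu (ring (k.*2 + 0)) + \sum_(k < n) mu (ring (k.*2 + 1)).
    rewrite -big_split /= big_mkord; elim: {s} n => [|n IH]; first by rewrite !big_ord0.
    by rewrite doubleS !big_ord_recr /= IH addn0 addn1 addeA.
  by apply: leeD; exact: sum_rings_le.
have s0 : 0 <= s by apply: nneseries_ge0 => k _ _; exact: outer_measure_ge0.
have sfin : s \is a fin_num.
  rewrite ge0_fin_numE //; apply: le_lt_trans s_le _.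
  by rewrite -(fineK muXfin) -EFinD ltry.
have step n :
    mu (X `&` A) + mu (X `&` ~` A) + \sum_(0 <= k < n) mu (ring k) <= mu X + s.
  rewrite /s (nneseries_split 0 n); last by move=> k _; exact: outer_measure_ge0.
  rewrite add0n addeA [leRHS]addeAC leeD2r //.
  apply: (@le_trans _ _
    (mu (X `&` A) + (mu (far n.+1) + \sum_(n <= k <oo) mu (ring k)))).
    rewrite leeD2l //.
    apply: le_trans (leeD2l _ (outer_measure_sigma_subadditive_tail mu n ring)).
    apply: le_trans (outer_measureU2 _ _ _); apply: le_outer_measure => x [Xx nAx].
    have dx : (0 < dist_to A x)%R.
      have [y [Ay xy]] := nearest_ex x A0 cA; rewrite -xy enorm_gt0 subr_eq0.
      by apply: contra_notN nAx => /eqP ->.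
    (* A point that is not far lies in the ring of the least [k] with [k.+3%:R^-1] at most its
       distance; the distance is below [n.+2%:R^-1], which forces this [k] to be at least [n]. *)
    have [xn|xn] := leP (n.+2%:R^-1)%R (dist_to A x); first by left.
    right.
    have exk : exists k, (k.+3%:R^-1 <= dist_to A x)%R.
      exists (Num.truncn (dist_to A x)^-1); rewrite invf_ple ?posrE //.
      apply/ltW; apply: lt_trans (truncnS_gt _) _.
      by rewrite ltr_nat ltnS leqnSn.
    have := ex_minnP exk; case=> k xk kmin; exists k => /=.
      rewrite /= => kn; move: xn; rewrite ltNge; apply/negP; rewrite negbK.
      by apply: le_trans xk; rewrite lef_pV2 ?posrE // ler_nat !ltnS.
    split => //; rewrite xk /= ltNge; apply/negP => xk2.
    case: k xk kmin xk2 => [|k] xk kmin xk2.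
      move: xk2; apply/negP; rewrite -ltNge; apply: lt_le_trans xn _.
      by rewrite lef_pV2 ?posrE // ler_nat.
    by have := kmin k xk2; rewrite ltnn.
  rewrite addeA leeD2r //.
  apply: (@le_trans _ _ (mu ((X `&` A) `|` far n.+1))).
    rewrite addeC setUC; apply: (mu_metric (eta := n.+2%:R^-1)) => //.
    move=> a b [_ an] [_ Ab]; exact: le_trans an (dist_to_le a Ab).
  by apply: le_outer_measure => x [[]|[]].
have cfin : mu (X `&` A) + mu (X `&` ~` A) \is a fin_num.
  by rewrite fin_numD !le_muX //; exact: subIsetl.
(* It remains to let [n] tend to infinity in [step] and cancel the finite [s]. *)
suff : s <= mu X + s - (mu (X `&` A) + mu (X `&` ~` A)).
  rewrite leeBrDr // addeC leeD2rE //.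
apply: lime_le; first by apply: is_cvg_nneseries => k _ _; exact: outer_measure_ge0.
by apply: nearW => n; rewrite leeBrDr // addeC.
Qed.

End ClosedSet.

Lemma caratheodory_borel (B : set E) : borel B -> mu.-caratheodory B.
Proof.
move: B; apply: smallest_sub.
  split; first exact: caratheodory_measurable_set0.
    by move=> A mA; rewrite setTD; exact: caratheodory_measurable_setC.
  by move=> F mF; exact: caratheodory_measurable_bigcup.
move=> A /= oA; rewrite -(setCK A); apply: caratheodory_measurable_setC.
(* An empty closed set is treated apart, as [dist_to] vanishes identically for it. *)
have [->|/set0P nA] := eqVneq (~` A) set0.
  exact: caratheodory_measurable_set0.
apply: le_caratheodory_measurable => X; apply: caratheodory_closed_le => //.
exact: open_closedC.
Qed.

Lemma sum_caratheodory_le n (F : 'I_n -> set E) (S : set E) :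
  (forall i, mu.-caratheodory (F i)) -> trivIset setT F ->
  \sum_(i < n) mu (S `&` F i) <= mu S.
Proof.
elim: n F S => [|n IH] F S mF tF; first by rewrite big_ord0 outer_measure_ge0.
rewrite big_ord_recl [leRHS](mF ord0) leeD2l //.
apply: le_trans (IH (fun i => F (lift ord0 i)) (S `&` ~` F ord0) _ _) => //; last first.
  by move=> i j _ _ ij; apply: (@lift_inj _ ord0); exact: tF ij.
apply: lee_sum => i _; apply: le_outer_measure => x [Sx Fx]; split => //; split => //.
move=> F0x; have := tF ord0 (lift ord0 i) I I (ex_intro _ x (conj F0x Fx)).
by move/eqP; rewrite (negbTE (neq_lift _ _)).
Qed.

End MetricOuterMeasure.

Section Hausdorff.
Variables (R : realType) (d m : nat).
Local Notation E := 'rV[R]_d.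
Implicit Types (A B U : set E) (delta : R).
Local Open Scope ereal_scope.

Lemma hausdorff_gauge_ge0 A : (0 <= hausdorff_gauge m A)%R.
Proof.
rewrite /hausdorff_gauge; case: asboolP => // _.
by rewrite mulr_ge0 ?exprn_ge0 ?divr_ge0 ?diam_ge0 // ltW // omega_gt0.
Qed.

Lemma hausdorff_gauge_set0 : hausdorff_gauge m (set0 : set E) = 0%R.
Proof. by rewrite /hausdorff_gauge; case: asboolP => // -[]. Qed.

Lemma hausdorff_gauge_le A (M : R) : (0 <= M)%R ->
  (forall x y, A x -> A y -> (enorm (x - y) <= M)%R) ->
  (hausdorff_gauge m A <= omega R m * (M / 2) ^+ m)%R.
Proof.
move=> M0 AM; have om := omega_gt0 R m; rewrite /hausdorff_gauge.
case: asboolP => _; last by rewrite mulr_ge0 ?exprn_ge0 ?divr_ge0 // ltW.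
rewrite ler_pM2l //; apply: lerXn2r; rewrite ?nnegrE ?divr_ge0 ?diam_ge0 //.
by rewrite ler_pM2r // diam_le.
Qed.

Let gauge_ge0 A : 0 <= (hausdorff_gauge m A)%:E.
Proof. by rewrite lee_fin hausdorff_gauge_ge0. Qed.

(* The gauge set to +oo on sets of diameter larger than delta, so that the
   library's outer measure construction over all subsets gives hausdorff_pre. *)
Definition truncated_gauge delta A : \bar R :=
  if `[< forall x y, A x -> A y -> (enorm (x - y) <= delta)%R >]
  then (hausdorff_gauge m A)%:E else +oo.

Lemma truncated_gauge_ge0 delta A : 0 <= truncated_gauge delta A.
Proof. by rewrite /truncated_gauge; case: asboolP. Qed.

Lemma hausdorff_preE delta A : hausdorff_pre m delta A =
  mu_ext (T := g_sigma_algebraType [set: set E]) (truncated_gauge delta) A.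
Proof.
apply/eqP; rewrite eq_le; apply/andP; split; apply/ereal_infP => _ /= [U + <-].
  move=> [_ AU].
  (* A cover with a member of diameter above [delta] costs [+oo] and leaves the infimum
     unchanged. *)
  have [Ud|/existsNP[i Ui]] := pselect
    (forall i x y, U i x -> U i y -> (enorm (x - y) <= delta)%R).
    apply: ereal_inf_lbound; exists U => //.
    by apply: eq_eseriesr => i _; rewrite /truncated_gauge;
    case: asboolP => // -[]; exact: Ud.
  rewrite (eseries_pinfty (k := i)) ?leey //.
    by move=> n _; rewrite gt_eqF // (lt_le_trans _ (truncated_gauge_ge0 _ _)).
  by rewrite /truncated_gauge; case: asboolP.
move=> [AU Ud]; apply: ereal_inf_lbound; exists U.
  by split => // i; apply: sub_sigma_algebra.
by apply: eq_eseriesr => i _; rewrite /truncated_gauge;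
    case: asboolP => // -[]; exact: Ud.
Qed.

Lemma hausdorff_pre_sigma_subadditive delta :
  sigma_subadditive (hausdorff_pre m delta : set E -> \bar R).
Proof.
have -> : hausdorff_pre m delta =
    mu_ext (T := g_sigma_algebraType [set: set E]) (truncated_gauge delta).
  by apply/funext => A; exact: hausdorff_preE.
exact: (@mu_ext_sigma_subadditive _ (g_sigma_algebraType [set: set E]) _ _
  (truncated_gauge_ge0 delta)).
Qed.

Lemma hausdorff_pre_ge0 delta A : 0 <= hausdorff_pre m delta A.
Proof. by rewrite hausdorff_preE mu_ext_ge0 //; exact: truncated_gauge_ge0. Qed.

Lemma le_hausdorff_pre delta A B : A `<=` B ->
  hausdorff_pre m delta A <= hausdorff_pre m delta B.
Proof. by move=> AB; rewrite !hausdorff_preE; exact: le_mu_ext. Qed.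

Lemma hausdorff_pre_set0 delta : hausdorff_pre m delta (set0 : set E) = 0.
Proof.
rewrite hausdorff_preE mu_ext0 //; last exact: truncated_gauge_ge0.
by rewrite /truncated_gauge hausdorff_gauge_set0; case: asboolP => // -[].
Qed.

Lemma hausdorff_pre_anti delta1 delta2 A : (delta1 <= delta2)%R ->
  hausdorff_pre m delta2 A <= hausdorff_pre m delta1 A.
Proof.
move=> d12; apply: ereal_inf_le_tmp => _ [U [AU Ud] <-]; exists U => //.
by split => // i x y Ux Uy; exact: le_trans (Ud i x y Ux Uy) d12.
Qed.

Lemma hausdorff_pre_le delta A : (0 < delta)%R ->
  hausdorff_pre m delta A <= hausdorff_measure m A.
Proof. by move=> d0; apply: ereal_sup_ubound; exists delta. Qed.

Lemma hausdorff_measure_set0 : hausdorff_measure m (set0 : set E) = 0.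
Proof.
apply/eqP; rewrite eq_le; apply/andP; split.
  by apply/ereal_supP => _ [delta _ <-]; rewrite hausdorff_pre_set0.
by apply: le_trans (hausdorff_pre_le _ ltr01); exact: hausdorff_pre_ge0.
Qed.

Lemma hausdorff_measure_ge0 A : 0 <= hausdorff_measure m A.
Proof. by apply: le_trans (hausdorff_pre_le _ ltr01); exact: hausdorff_pre_ge0. Qed.

Lemma le_hausdorff_measure :
  {homo (hausdorff_measure m : set E -> \bar R) : A B / A `<=` B >-> A <= B}.
Proof.
move=> A B AB; apply/ereal_supP => _ [delta d0 <-].
by apply: le_trans (hausdorff_pre_le _ d0); exact: le_hausdorff_pre.
Qed.

Lemma hausdorff_measure_sigma_subadditive :
  sigma_subadditive (hausdorff_measure m : set E -> \bar R).
Proof.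
move=> F; apply/ereal_supP => _ [delta d0 <-].
apply: le_trans (hausdorff_pre_sigma_subadditive _ _) _.
apply: lee_nneseries => [i _ _|i _]; first exact: hausdorff_pre_ge0.
exact: hausdorff_pre_le.
Qed.

HB.instance Definition _ := isOuterMeasure.Build R E (hausdorff_measure m)
  hausdorff_measure_set0 hausdorff_measure_ge0 le_hausdorff_measure
  hausdorff_measure_sigma_subadditive.

(** A set of diameter at most [delta] cannot meet both [A] and [B], so a cover of the union splits
    into the members meeting [A] and those meeting [B]. *)
Lemma hausdorff_pre_metric delta A B (eta : R) : (0 < delta)%R -> (delta < eta)%R ->
  (forall a b, A a -> B b -> (eta <= enorm (a - b))%R) ->
  hausdorff_pre m delta A + hausdorff_pre m delta B <= hausdorff_pre m delta (A `|` B).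
Proof.
move=> d0 de AB; apply/ereal_infP => _ [U [ABU Ud] <-].
pose V (C : set E) i := if `[< U i `&` C !=set0 >] then U i else set0.
have Vd C i x y : V C i x -> V C i y -> (enorm (x - y) <= delta)%R.
  by rewrite /V; case: asboolP => // _; exact: Ud.
have CV C : C `<=` A `|` B -> C `<=` \bigcup_i V C i.
  move=> CAB x Cx; have [i _ Uix] := ABU x (CAB _ Cx); exists i => //.
  by rewrite /V; case: asboolP => // -[]; exists x.
have preV C : C `<=` A `|` B ->
    hausdorff_pre m delta C <= \sum_(i <oo) (hausdorff_gauge m (V C i))%:E.
  move=> CAB; apply: ereal_inf_lbound; exists (V C) => //; split; first exact: CV.
  exact: Vd.
apply: le_trans (leeD (preV A _) (preV B _)) _; [by left|by right|].
rewrite -nneseriesD //; apply: lee_nneseries => [i _ _|i _].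
  by rewrite adde_ge0.
rewrite -EFinD lee_fin /V.
case: asboolP => [[a [Ua Aa]]|_]; case: asboolP => [[b [Ub Bb]]|_];
  rewrite ?hausdorff_gauge_set0 ?addr0 ?add0r ?hausdorff_gauge_ge0 //.
by have := AB _ _ Aa Bb; rewrite leNgt (le_lt_trans (Ud i _ _ Ua Ub) de).
Qed.

Lemma hausdorff_measure_metric A B (eta : R) : (0 < eta)%R ->
  (forall a b, A a -> B b -> (eta <= enorm (a - b))%R) ->
  hausdorff_measure m A + hausdorff_measure m B <= hausdorff_measure m (A `|` B).
Proof.
move=> e0 AB; apply: ereal_sup_add_le.
- by exists (hausdorff_pre m 1%R A), 1%R => //=.
- by exists (hausdorff_pre m 1%R B), 1%R => //=.
- by move=> _ [delta _ <-]; exact: hausdorff_pre_ge0.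
- by move=> _ [delta _ <-]; exact: hausdorff_pre_ge0.
move=> _ _ [d1 /= d10 <-] [d2 /= d20 <-].
(* The premeasure grows as [delta] shrinks, so one scale below [eta] replaces both [d1] and [d2]. *)
pose delta : R := Num.min (Num.min d1 d2) (eta / 2)%R.
have dl0 : (0 < delta)%R by rewrite !lt_min d10 d20 divr_gt0.
apply: le_trans (hausdorff_pre_le _ dl0).
apply: le_trans (hausdorff_pre_metric dl0 _ AB); last first.
  apply: (@le_lt_trans _ _ (eta / 2)%R); first by rewrite ge_min lexx orbT.
  by rewrite ltr_pdivrMr // ltr_pMr // ltr1n.
by apply: leeD; apply: hausdorff_pre_anti; rewrite !ge_min lexx ?orbT.
Qed.

Lemma sum_hausdorff_borel_le n (F : 'I_n -> set E) (S : set E) :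
  (forall i, borel (F i)) -> trivIset setT F ->
  \sum_(i < n) hausdorff_measure m (S `&` F i) <= hausdorff_measure m S.
Proof.
move=> bF; apply: sum_caratheodory_le => i.
apply: caratheodory_borel => //; exact: hausdorff_measure_metric.
Qed.

Lemma hausdorff_pre_finite_cover (I : finType) (W : I -> set E) delta A :
  A `<=` \bigcup_i W i ->
  (forall i x y, W i x -> W i y -> (enorm (x - y) <= delta)%R) ->
  hausdorff_pre m delta A <= \sum_i (hausdorff_gauge m (W i))%:E.
Proof.
move=> AW Wd.
(* The family is enumerated and padded with empty sets, whose gauge is 0 in every dimension. *)
pose U n := if insub n is Some j then W (enum_val (j : 'I_#|I|)) else set0.
apply: (@le_trans _ _ (\sum_(n <oo) (hausdorff_gauge m (U n))%:E)).
  apply: ereal_inf_lbound; exists U => //; split.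
    move=> x /AW[i _ Wix]; exists (enum_rank i) => //.
    by rewrite /U valK enum_rankK.
  by move=> n x y; rewrite /U; case: insub => // j; exact: Wd.
rewrite (nneseries_split 0 #|I|); last by move=> k _.
rewrite [X in _ + X]eseries0 ?adde0; last first.
  move=> k; rewrite add0n => kI _; rewrite /U insubF ?hausdorff_gauge_set0 //.
  by rewrite ltnNge kI.
rewrite add0n big_mkord [leRHS](reindex _ (onW_bij _ (@enum_val_bij I))) /=.
by apply: lee_sum => j _; rewrite /U valK.
Qed.

End Hausdorff.

(** * The area of the boundary of a parallel set *)

Section BoundaryMeasure.
Variables (R : realType) (d : nat) (K : set 'rV[R]_d) (r : R).
Local Notation E := 'rV[R]_d.
Hypotheses (d0 : (0 < d)%N) (K0 : K !=set0) (cK : compact K) (r0 : 0 < r).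
Hypothesis Dr : 2 * diam K ^+ 2 <= r ^+ 2.
Local Notation D := (diam K).
Local Notation S := (frontier (parallel_set K r)).
Local Notation dist := (dist_to K).

Let Dltr : D < r := diam_lt_of_sqr r0 Dr.

(** The interval from -1 to 1 is cut into [N.+1] cells; the subtracted numbers are their centres and
    the bound is half their width. In the proof [s] is the position of [t] in units of cells. *)
Lemma grid_cell (N : nat) (t : R) : `|t| <= 1 -> exists c : 'I_N.+1,
  `|t - (c.*2.+1%:R / N.+1%:R - 1)| <= N.+1%:R^-1.
Proof.
rewrite ler_norml => /andP[t1 t2].
have N0 : (0 : R) < N.+1%:R by [].
pose s := (t + 1) * N.+1%:R / 2.
have s0 : 0 <= s by rewrite divr_ge0 // mulr_ge0 // -lerBlDr sub0r.
have sN : s <= N.+1%:R.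
  rewrite /s ler_pdivrMr // mulrC ler_pM2l //; lra.
have [c [c1 c2]] : exists c : 'I_N.+1, c%:R <= s /\ s <= c.+1%:R.
  elim: N {t t1 t2 N0} s s0 sN => [|N IH] s s0 sN; first by exists ord0.
  have [sN'|/ltW sN'] := leP s N.+1%:R; last by exists ord_max.
  have [c [c1 c2]] := IH s s0 sN'.
  by exists (widen_ord (leqnSn _) c).
exists c.
have -> : t - (c.*2.+1%:R / N.+1%:R - 1) = (s * 2 - c.*2.+1%:R) / N.+1%:R.
  by rewrite /s; field.
rewrite normrM [X in _ * X]gtr0_norm ?invr_gt0 //.
rewrite ler_piMl ?invr_ge0 // ler_norml.
have -> : c.*2.+1%:R = c%:R * 2 + 1 :> R by rewrite -natr1 -muln2 natrM.
by move: c2; rewrite -natr1; lra.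
Qed.

(* The radial projection from a point of K onto the surface of a cube has a
   Lipschitz inverse on the boundary of K(r). *)
Lemma frontier_radial_le x0 x y : K x0 -> S x -> S y ->
  let a := `|x - x0| in let b := `|y - x0| in
  enorm (x - y) <=
    (16 *+ d + 2) * r * enorm (a^-1 *: (x - x0) - b^-1 *: (y - x0)).
Proof.
move=> Kx0; rewrite frontierE //=.
set L := 16 *+ d + 2.
have aux z : dist z = r -> 0 < `|z - x0| <= 2 * r.
  move=> zr; rewrite normr_gt0; apply/andP; split.
    apply: contraTneq r0; move=> e; rewrite -leNgt -zr.
    by rewrite (le_trans (dist_to_le z Kx0)) // e enorm0.
  apply: le_trans (norm_le_enorm _) _.
  by apply: (parallel_set_ball K0 cK r0 Dr Kx0); rewrite /parallel_set /= zr.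
wlog ba : x y / `|y - x0| <= `|x - x0|.
  move=> h xr yr; have [l|/ltW l] := leP `|y - x0| `|x - x0|; first exact: h.
  by have := h y x l yr xr; rewrite enormC (enormC (_ *: (y - x0))).
move=> xr yr; have /andP[a0 a2] := aux x xr; have /andP[b0 b2] := aux y yr.
set a := `|x - x0| in a0 a2 ba *; set b := `|y - x0| in b0 b2 ba *.
set v := a^-1 *: _; set w := b^-1 *: _.
have xE : x - x0 = a *: v by rewrite scalerA mulfV ?gt_eqF // scale1r.
have yE : y - x0 = b *: w by rewrite scalerA mulfV ?gt_eqF // scale1r.
have v1 : enorm v <= d%:R.
  apply: le_trans (enorm_le_norm _) _.
  by rewrite normrZ ger0_norm ?invr_ge0 ?normr_ge0 // mulVf ?gt_eqF.
clearbody v w.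
have [p [Kp xp]] := nearest_ex x K0 (rV_compact_closed cK).
pose s := b / a.
have s1 : 0 <= 1 - s by rewrite subr_ge0 /s ler_pdivrMr // mul1r.
have s0 : 0 <= s by rewrite divr_ge0 // ltW.
(* The hypothesis bounds the square of [D / r] by 1/2, which is less than 9/16. *)
have rho : r / 4 <= r - D.
  suff : D <= 3 / 4 * r by lra.
  rewrite -ler_sqr ?nnegrE ?diam_ge0 ?mulr_ge0 ?(ltW r0) // exprMn.
  have : 0 < r ^+ 2 by rewrite exprn_gt0.
  have -> : (3 / 4) ^+ 2 = 9 / 16 :> R by field.
  by move: Dr; lra.
(* The point [x0 + b *: v] divides the segment from [x0] to [x] in ratio [s], so its distance to [p]
   is at most [r - (1 - s) * (r - D)]. Since [y = x0 + b *: w] has distance at least [r] to [p], the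
   two points differ by the gap. *)
have gap : (1 - s) * (r - D) <= b * enorm (v - w).
  have yp : r <= enorm (y - p) by rewrite -yr dist_to_le.
  have e : y - p = (b *: (w - v)) + (s *: (x - p) + (1 - s) *: (x0 - p)).
    have bsv : b *: v = s *: (x - x0).
      by rewrite xE scalerA /s divfK ?gt_eqF.
    rewrite scalerBr -yE bsv; apply/rowP => i; rewrite !mxE; ring.
  have h1 := ler_enormD (b *: (w - v)) (s *: (x - p) + (1 - s) *: (x0 - p)).
  have h2 := ler_enormD (s *: (x - p)) ((1 - s) *: (x0 - p)).
  have h3 := diam_bounded (compact_enorm_bounded cK) Kx0 Kp.
  move: h1 h2; rewrite -e !enormZ !ger0_norm ?(ltW b0) // xp xr (enormC w) => h1 h2.
  have h4 : (1 - s) * enorm (x0 - p) <= (1 - s) * D by rewrite ler_wpM2l.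
  by move: yp h1 h2 h4; lra.
set e := enorm (v - w) in gap *.
have e0 : 0 <= e by exact: enorm_ge0.
(* The factor 16 comes from [a * b <= 4 * r ^+ 2] divided by [r / 4]. *)
have ab : a - b <= 16 * r * e.
  have h1 : (a - b) * (r / 4) <= (a - b) * (r - D).
    by rewrite ler_wpM2l // subr_ge0.
  have h2 : (a - b) * (r - D) <= a * b * e.
    have -> : a - b = a * (1 - s).
      by rewrite /s mulrBr mulr1 mulrCA mulfV ?gt_eqF ?mulr1.
    by rewrite -!mulrA ler_pM2l.
  have h3 : a * b * e <= 2 * r * (2 * r) * e.
    by apply: ler_wpM2r => //; apply: ler_pM => //; exact: ltW.
  rewrite -(ler_pM2r (x := r / 4)) ?divr_gt0 //.
  by move: h1 h2 h3; lra.
(* A radial and an angular part; [v] has sup norm 1, hence Euclidean norm at most [d]. *)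
have -> : x - y = (a - b) *: v + b *: (v - w).
  rewrite scalerBl scalerBr addrA subrK -xE -yE.
  by rewrite opprB addrA subrK.
apply: le_trans (ler_enormD _ _) _; rewrite !enormZ !ger0_norm ?subr_ge0 ?(ltW b0) //.
rewrite -/e.
have h1 : (a - b) * enorm v <= 16 * r * e * d%:R.
  by apply: ler_pM => //; rewrite ?subr_ge0 ?enorm_ge0.
have h2 : b * e <= 2 * r * e by rewrite ler_wpM2r.
have -> : L * r * e = 16 * r * e * d%:R + 2 * r * e.
  by rewrite /L -mulr_natr; ring.
exact: lerD.
Qed.

(** The surface of the cube is cut into [d * 2 * N.+1 ^ d.-1] cells, whose preimages in [S] have
    diameter of order [r / N.+1]. The powers of [N.+1] cancel, so the bound is the same at every
    scale [delta]. *)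
Lemma hausdorff_frontier_le :
  (hausdorff_measure d.-1 S <=
   ((d * 2)%:R * (omega R d.-1 * ((16 *+ d + 2) *+ d) ^+ d.-1) * r ^+ d.-1)%:E)%E.
Proof.
have [x0 Kx0] := K0.
apply/ereal_supP => _ [delta /= delta0 <-].
set L := 16 *+ d + 2.
have L0 : 0 < L by rewrite ltr_wpDl // mulrn_wge0.
have Lr0 : 0 < (L * r *+ d) * 2 by rewrite mulr_gt0 // pmulrn_rgt0 // mulr_gt0.
have [N Nlt] : exists N, L * r *+ d * 2 / delta < N.+1%:R.
  by exists (Num.truncn (L * r *+ d * 2 / delta)); exact: truncnS_gt.
have N0 : (0 : R) < N.+1%:R by [].
(* The Lipschitz constant of the inverse radial projection times a bound on the Euclidean diameter
   of a grid cell. *)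
pose M := L * r * (2 / N.+1%:R *+ d).
have M0 : 0 <= M by rewrite !mulr_ge0 ?(ltW L0) ?(ltW r0) ?mulrn_wge0 ?divr_ge0.
have Mdelta : M <= delta.
  have -> : M = (L * r *+ d) * 2 / N.+1%:R by rewrite /M; ring.
  rewrite ler_pdivrMr // [leRHS]mulrC -ler_pdivrMr //.
  exact: ltW.
pose v x := `|x - x0|^-1 *: (x - x0).
(* A cell is given by the coordinate that is constant on its face, the sign of that coordinate, and
   a grid index for each other coordinate. *)
pose I : finType := ('I_d * bool * {ffun 'I_d.-1 -> 'I_N.+1})%type.
pose W (i : I) : set E := [set x | [/\ S x, v x ord0 i.1.1 = (-1) ^+ i.1.2 &
  forall j, `|v x ord0 (lift i.1.1 j) - ((i.2 j).*2.+1%:R / N.+1%:R - 1)|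
    <= N.+1%:R^-1]].
have xx0 x : S x -> 0 < `|x - x0|.
  rewrite frontierE //= => xr.
  rewrite normr_gt0; apply: contraTneq r0; move=> e; rewrite -leNgt -xr.
  by rewrite (le_trans (dist_to_le x Kx0)) // e enorm0.
have cover : S `<=` \bigcup_i W i.
  move=> x Sx; have a0 := xx0 x Sx.
  have vnorm : `|v x| = 1.
    by rewrite normrZ ger0_norm ?invr_ge0 // mulVf // gt_eqF.
  have [k vk] : exists k, `|v x ord0 k| = 1.
    have [|[k1 k] /= e] := @mx_norm_neq0 _ _ _ (v x).
      by move: vnorm; rewrite /Num.norm /= => ->; rewrite oner_neq0.
    exists k; rewrite -[RHS]vnorm [RHS]/Num.norm /= e.
    by rewrite (ord1 k1).
  have /choice[c cP] (j : 'I_d.-1) :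
      exists c : 'I_N.+1,
        `|v x ord0 (lift k j) - (c.*2.+1%:R / N.+1%:R - 1)| <= N.+1%:R^-1.
    by apply: grid_cell; rewrite -vnorm coord_le_norm.
  exists ((k, v x ord0 k < 0), [ffun j => c j]) => //; split => //=.
    by rewrite [LHS]numEsign vk mulr1.
  by move=> j; rewrite ffunE.
have Wd i x y : W i x -> W i y -> enorm (x - y) <= M.
  move=> [Sx xi xj] [Sy yi yj]; apply: le_trans (frontier_radial_le Kx0 Sx Sy) _.
  rewrite -/L ler_pM2l ?mulr_gt0 //; apply: enorm_le_coord => k.
  have -> : (v x - v y) ord0 k = v x ord0 k - v y ord0 k by rewrite !mxE.
  have [<-|/unlift_some[j -> _]] := eqVneq i.1.1 k.
    by rewrite xi yi subrr normr0 divr_ge0.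
  apply: le_trans (ler_distD ((i.2 j).*2.+1%:R / N.+1%:R - 1) _ _) _.
  by rewrite -[2]natr1 mulrDl mul1r lerD // distrC.
have Wdelta i x y : W i x -> W i y -> enorm (x - y) <= delta.
  by move=> Wx Wy; exact: le_trans (Wd i x y Wx Wy) Mdelta.
apply: le_trans (hausdorff_pre_finite_cover d.-1 cover Wdelta) _.
rewrite sumEFin lee_fin.
apply: (@le_trans _ _ (\sum_(i : I) omega R d.-1 * (M / 2) ^+ d.-1)).
  by apply: ler_sum => i _; apply: hausdorff_gauge_le => //; exact: Wd.
rewrite sumr_const cardE -cardE !card_prod card_bool card_ffun !card_ord.
rewrite -[leLHS]mulr_natr.
have -> : M / 2 = (L *+ d) * r / N.+1%:R by rewrite /M; field.
rewrite expr_div_n exprMn natrM natrX.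
have : N.+1%:R ^+ d.-1 != 0 :> R by rewrite expf_neq0 // gt_eqF.
move: (N.+1%:R ^+ d.-1) => A A0.
by rewrite le_eqVlt; apply/orP; left; apply/eqP; field.
Qed.

End BoundaryMeasure.

(** * Variation bounds uniform in the set and the radius *)

Section Variation.
Variables (R : realType) (d : nat).
Local Notation E := 'rV[R]_d.

Lemma variation_measure_le (mu : set E -> \bar R) (A : set E) (c : \bar R) :
  (forall n (F : 'I_n -> set E), (forall i, borel (F i) /\ bounded_set (F i)) ->
     trivIset setT F -> (\sum_(i < n) `|mu (F i)| <= c)%E) ->
  (variation_measure mu A <= c)%E.
Proof.
move=> h; apply/ereal_supP => _ [n [F [FP tF ->]]]; apply: h => // i.
by have [] := FP i.
Qed.

(** Nodes and weights are fixed before [K] and [r], which makes the resulting constant uniform. *)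
Lemma equidistributed_weights (k : 'I_d.+1) : exists t a : 'I_d.+1 -> R,
  (forall j, 0 < t j <= 2^-1) /\
  (forall i : 'I_d.+1, \sum_j a j * t j ^+ i = (i == rev_ord k)%:R).
Proof.
pose t (j : 'I_d.+1) : R := j.+1%:R / d.+1%:R / 2.
have [|a aP] := vandermonde_weights (rev_ord k) (t := t).
  move=> i j /(divIf _)/(divIf _) h; apply: val_inj.
  have /eqP := h (lt0r_neq0 (ltr0Sn _ _)) (lt0r_neq0 (ltr0Sn _ _)).
  by rewrite eqr_nat eqSS => /eqP.
exists t, a; split => // j; rewrite !divr_gt0 //= ler_pdivrMr // mulVf //.
by rewrite ler_pdivrMr // mul1r ler_nat.
Qed.

Lemma parallel_variation_bound (k : nat) : (0 < d)%N -> (k <= d)%N ->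
  exists c : R, forall (K : set E) (r : R), K !=set0 -> compact K -> 0 < r ->
    2 * diam K ^+ 2 <= r ^+ 2 ->
    (variation_measure (parallel_curvature K r k) setT <= (c * r ^+ k)%:E)%E.
Proof.
move=> d0 kd; rewrite /parallel_curvature.
have [->|kNd] := eqVneq k d.
  exists (4 ^+ d) => K r K0 cK r0 Dr; rewrite -exprMn.
  apply: variation_measure_le => n F _ tF.
  apply: le_trans (vol_parallel_le K0 cK r0 Dr).
  under eq_bigr do rewrite gee0_abs ?vol_ge0 //.
  apply: sum_vol_le; last by move=> i; exact: subIsetl.
  exact: trivIset_setIl.
have [kE|kNd1] := eqVneq k.+1 d.
  exists ((d * 2)%:R * (omega R d.-1 * ((16 *+ d + 2) *+ d) ^+ d.-1)).
  move=> K r K0 cK r0 Dr.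
  have kd1 : k = d.-1 by rewrite -kE.
  apply: variation_measure_le => n F bF tF.
  under eq_bigr do rewrite gee0_abs ?hausdorff_measure_ge0 //.
  rewrite {1}kd1; apply: le_trans (hausdorff_frontier_le d0 K0 cK r0 Dr).
  by apply: sum_hausdorff_borel_le => // i; case: (bF i).
have kd' : (k < d)%N by rewrite ltn_neqAle kNd.
have [t [a [t01 aP]]] := equidistributed_weights (Ordinal (ltnW kd' : (k < d.+1)%N)).
exists ((\sum_j `|a j|) * 4 ^+ d / omega R (d - k)) => K r K0 cK r0 Dr.
apply: variation_measure_le => n F bF tF.
under eq_bigr do rewrite EFinM abseM abse_EFin normrX normrN1 expr1n mul1e abse_EFin.
rewrite sumEFin lee_fin.
(* Without a Steiner formula [xget] returns the zero family. *)
rewrite /curvature_measures; case: xgetP => [C _ CP|_].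
  exact: (curvature_sum_le (k := Ordinal (ltnW kd' : (k < d.+1)%N))
    d0 K0 cK r0 Dr kd' t01 aP CP bF tF).
rewrite big1 => [|i _]; last by rewrite normr0.
rewrite !mulr_ge0 ?invr_ge0 ?exprn_ge0 ?(ltW r0) ?(ltW (omega_gt0 _ _)) //.
exact: sumr_ge0.
Qed.

End Variation.

Theorem theorem5p1 (R : realType) (d : nat) (d_gt0 : (0 < d)%N)
    (q : R) (q_gt : Num.sqrt 2 < q) (k : nat) (k_le : (k <= d)%N) :
  exists c : R, forall K : set 'rV[R]_d, K !=set0 -> compact K ->
    (forall r : R, 0 < r -> q * diam K <= r ->
       ((diam K * Num.sqrt (q ^+ 2 - 1))%:E <= reach (copar_set K r))%E /\
       lipschitz_submanifold d.-1 (frontier (parallel_set K r))) /\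
    (ereal_sup [set (variation_measure (parallel_curvature K r k) setT * (r ^- k)%:E)%E
       | r in [set r : R | (0 < r)%R /\ (q * diam K <= r)%R]] <= c%:E)%E.
Proof.
have q0 : 0 < q by apply: le_lt_trans q_gt; exact: sqrtr_ge0.
have q2 : 2 < q ^+ 2.
  by rewrite -(sqr_sqrtr (ltW (ltr0n R 2))) ltr_sqr ?nnegrE ?sqrtr_ge0 ?ltW.
have qD (K : set 'rV[R]_d) r : 0 < r -> q * diam K <= r ->
    q ^+ 2 * diam K ^+ 2 <= r ^+ 2.
  move=> r0 qr; rewrite -exprMn; apply: lerXn2r => //.
    by rewrite nnegrE mulr_ge0 ?diam_ge0 ?ltW.
  by rewrite nnegrE ltW.
have Dr (K : set 'rV[R]_d) r : 0 < r -> q * diam K <= r ->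
    2 * diam K ^+ 2 <= r ^+ 2.
  move=> r0 /(qD K r r0); apply: le_trans.
  by rewrite ler_wpM2r ?sqr_ge0 ?ltW.
(* In this bound [q] enters only through [Dr], so the constant depends on [d] and [k] alone. *)
have [c cP] := parallel_variation_bound R d_gt0 k_le.
exists c => K K0 cK; split=> [r r0 qr|].
  have Dr' := Dr K r r0 qr; split; last exact: frontier_lipschitz.
  apply: le_trans (reach_copar K0 cK r0 (diam_lt_of_sqr r0 Dr') d_gt0).
  (* Under one square root the claim is [q ^+ 2 * diam K ^+ 2 <= r ^+ 2]. *)
  rewrite lee_fin -[X in X * _](ger0_norm (diam_ge0 K)) -sqrtr_sqr.
  rewrite -sqrtrM ?sqr_ge0 //; apply: ler_wsqrtr.
  by have := qD K r r0 qr; lra.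
apply/ereal_supP => _ [r [r0 qr] <-].
have rk : 0 < r ^- k by rewrite invr_gt0 exprn_gt0.
apply: le_trans (lee_wpmul2r _ (cP K r K0 cK r0 (Dr K r r0 qr))) _.
  by rewrite lee_fin ltW.
by rewrite -EFinM lee_fin -mulrA mulfV ?mulr1 // gt_eqF // exprn_gt0.
Qed.
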